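(* Let $\boldsymbol{Y}$ be the Brownian motion in $\mathbb{R}^d$, with transition density $p(t,y)=(2\pi t)^{-d/2}e^{-|y|^2/(2t)}$. Then for all $\lambda>0$, $t>0$ the density $p_\lambda(t,x,y)$ of the corresponding process $\boldsymbol{X}$ with resetting exists and, for any $x\in\mathbb{R}^d$: 1. For every $M>\frac{1}{\sqrt{2\lambda}}$, $$p_\lambda(t,x,y)\sim\frac{\lambda^{\frac{d+1}{4}}}{2^{\frac{d+1}{4}}\pi^{\frac{d-1}{2}}}\,\frac{e^{-\sqrt{2\lambda}|y|}}{|y|^{\frac{d-1}{2}}}\quad\text{on}\quad\frac{t}{|y|}\ge M.$$ 2. For every $0<M<\frac{1}{\sqrt{2\lambda}}$, $$p_\lambda(t,x,y)\sim e^{-\lambda t}p(t,y)\left(\frac{2\lambda}{(|y|/t)^2-2\lambda}+e^{\frac{-|x|^2+2\langle x,y\rangle}{2t}}\right)\quad\text{on}\quad0<\frac{t}{|y|}\le M.$$ 3. For $\frac{t}{|y|}=\frac{1}{\sqrt{2\lambda}}$, $$p_\lambda(t,x,y)\sim\frac{\lambda^{\frac{d+1}{4}}}{2\cdot2^{\frac{d+1}{4}}\pi^{\frac{d-1}{2}}}\,\frac{e^{-\sqrt{2\lambda}|y|}}{|y|^{\frac{d-1}{2}}}.$$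
   Context: Let $d\ge1$. Under $\mathbb{P}^x$ the process $\boldsymbol{Y}$ starts from $x$; here $\boldsymbol{Y}$ is Brownian motion with $\mathbb{E}^0e^{i\langle\xi,Y_t\rangle}=e^{-t|\xi|^2/2}$. Let $\boldsymbol{N}$ be a Poisson process with intensity $\lambda>0$, independent of $\boldsymbol{Y}$, with arrival times $T_1<T_2<\dots$. The process with (total) resetting is $X_t=Y_t$ for $t<T_1$ and $X_t=Y_t-Y_{T_n}$ for $T_n\le t<T_{n+1}$, $n\ge1$. Its density under $\mathbb{P}^x$ is taken in the version $$p_\lambda(t,x,y)=e^{-\lambda t}p(t,y-x)+\int_0^t\lambda e^{-\lambda s}p(s,y)\,ds.$$ Notation: $A(t,y)\sim B(t,y)$ means $\lim_{|y|\to\infty,\ t\to\infty}A(t,y)/B(t,y)=1$ (joint limit as both $|y|\to\infty$ and $t\to\infty$, with $x$ and $\lambda$ fixed); ''on'' a region, or ''for'' a relation between $t$ and $|y|$, means that the limit is taken along $(t,y)$ satisfying that restriction. *)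

(* Defs.v *)
From HB Require Import structures.
From mathcomp Require Import all_boot all_order all_algebra.
From mathcomp Require Import all_classical all_reals all_analysis.
From mathcomp Require Import measurable_realfun.

Set Implicit Arguments.
Unset Strict Implicit.
Unset Printing Implicit Defensive.

Import Order.TTheory GRing.Theory Num.Theory.
Import numFieldNormedType.Exports.

Local Open Scope classical_set_scope.
Local Open Scope ring_scope.

(* The sigma-algebra on R^n is generated by the coordinate functions; this is
   the Borel sigma-algebra. *)

Definition rV_display : measure_display -> measure_display.
Proof. exact. Qed.

Section measurable_rV.
Context {d : measure_display} {T : measurableType d}.
Variable n : nat.

Let coord_rV (i : 'I_n) (v : 'rV[T]_n) : T := v ord0 i.

Let rV_measurable0 : g_sigma_preimage coord_rV set0.
Proof. exact: sigma_algebra0. Qed.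

Let rV_measurableC A :
  g_sigma_preimage coord_rV A -> g_sigma_preimage coord_rV (~` A).
Proof. exact: sigma_algebraC. Qed.

Let rV_measurable_bigcup (F : (set 'rV[T]_n)^nat) :
  (forall i, g_sigma_preimage coord_rV (F i)) ->
  g_sigma_preimage coord_rV (\bigcup_i F i).
Proof. exact: sigma_algebra_bigcup. Qed.

HB.instance Definition _ := @isMeasurable.Build (rV_display d) 'rV[T]_n
  (g_sigma_preimage coord_rV)
  rV_measurable0 rV_measurableC rV_measurable_bigcup.

Lemma measurable_coord_rV (i : 'I_n) :
  measurable_fun [set: 'rV[T]_n] (fun v => v ord0 i).
Proof.
move=> _ A mA; rewrite setTI; apply: sub_sigma_algebra => /=.
rewrite -bigcup_seq/=; exists i => /=; first by rewrite mem_index_enum.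
by exists A => //; rewrite setTI.
Qed.

Lemma measurable_fun_rV d' (T' : measurableType d') (f : T' -> 'rV[T]_n) :
  (forall i, measurable_fun setT (fun x => f x ord0 i)) ->
  measurable_fun setT f.
Proof.
move=> mf _ A mA; rewrite setTI.
suff H : @measurable _ ('rV[T]_n) `<=` [set B | measurable (f @^-1` B)].
  exact: H.
apply: smallest_sub.
  split => /=.
  - by rewrite preimage_set0.
  - by move=> B mB; rewrite setTD preimage_setC; exact: measurableC.
  - by move=> F mF; rewrite preimage_bigcup; exact: bigcup_measurable.
move=> B; rewrite -bigcup_seq /= => -[i _] [C mC <-].
by have := mf i measurableT C mC; rewrite !setTI.
Qed.

End measurable_rV.

Section lebesgue_rV.
Context {R : realType}.

Definition cons_rV n (u : measurableTypeR R * 'rV[R]_n) : 'rV[R]_n.+1 :=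
  row_mx (u.1%:M : 'rV_1) u.2.

Lemma cons_rV0 n (u : measurableTypeR R * 'rV[R]_n) : cons_rV u ord0 ord0 = u.1.
Proof.
have -> : (ord0 : 'I_n.+1) = lshift n (ord0 : 'I_1) by exact/val_inj.
by rewrite [LHS]row_mxEl mxE eqxx mulr1n.
Qed.

Lemma cons_rVS n (u : measurableTypeR R * 'rV[R]_n) i :
  cons_rV u ord0 (lift ord0 i) = u.2 ord0 i.
Proof.
have -> : lift ord0 i = rshift 1 i by exact/val_inj.
by rewrite [LHS]row_mxEr.
Qed.

Lemma measurable_cons_rV n : measurable_fun setT (@cons_rV n).
Proof.
apply: measurable_fun_rV => i.
case: (unliftP ord0 i) => [j|] ->.
  rewrite (_ : (fun _ => _) = (fun v : 'rV[R]_n => v ord0 j) \o snd); last first.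
    by apply/funext => u /=; rewrite cons_rVS.
  by apply: measurableT_comp => //; exact: measurable_coord_rV.
by under eq_fun do rewrite cons_rV0; exact: measurable_fst.
Qed.

Section step.
Variables (n : nat) (mu : {sigma_finite_measure set 'rV[R]_n -> \bar R}).

Definition lebesgue_rV_step : set 'rV[R]_n.+1 -> \bar R :=
  pushforward (lebesgue_measure \x mu)%E (@cons_rV n).

Let lebesgue_rV_step0 : lebesgue_rV_step set0 = 0%E.
Proof. by rewrite /lebesgue_rV_step /pushforward preimage_set0 measure0. Qed.

Let lebesgue_rV_step_ge0 A : (0 <= lebesgue_rV_step A)%E.
Proof. by rewrite /lebesgue_rV_step /pushforward measure_ge0. Qed.

Let lebesgue_rV_step_sigma_additive : semi_sigma_additive lebesgue_rV_step.
Proof.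
have mcons A : measurable A -> measurable (@cons_rV n @^-1` A).
  by move=> mA; rewrite -[X in measurable X]setTI; exact: measurable_cons_rV.
move=> F mF tF mUF; rewrite /lebesgue_rV_step /pushforward preimage_bigcup.
apply: measure_semi_sigma_additive.
- by move=> k; exact: mcons.
- apply/trivIsetP => /= i j _ _ ij; rewrite -preimage_setI.
  by move/trivIsetP : tF => /(_ _ _ I I ij) ->; rewrite preimage_set0.
- by rewrite -preimage_bigcup; exact: mcons.
Qed.

HB.instance Definition _ := isMeasure.Build _ _ _ lebesgue_rV_step
  lebesgue_rV_step0 lebesgue_rV_step_ge0 lebesgue_rV_step_sigma_additive.

Lemma lebesgue_rV_step_sigma_finite : sigma_finite setT lebesgue_rV_step.
Proof.
have /sigma_finiteP[F [UF ndF mF]] := sigma_finiteT (@lebesgue_measure R).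
have /sigma_finiteP[G [UG ndG mG]] := sigma_finiteT mu.
pose uncons (v : 'rV[R]_n.+1) : measurableTypeR R * 'rV[R]_n :=
  (v ord0 ord0, \row_i v ord0 (lift ord0 i)).
have unconsK : cancel uncons (@cons_rV n).
  move=> v; apply/rowP => i; case: (unliftP ord0 i) => [j|] ->.
    by rewrite cons_rVS mxE.
  by rewrite cons_rV0.
have consK : cancel (@cons_rV n) uncons.
  move=> [x v]; rewrite /uncons cons_rV0; congr (_, _).
  by apply/rowP => i; rewrite mxE cons_rVS.
have muncons : measurable_fun setT uncons.
  apply: measurable_fun_pair => /=; first exact: measurable_coord_rV.
  apply: measurable_fun_rV => i; under eq_fun do rewrite mxE.
  exact: measurable_coord_rV.
exists (fun k => uncons @^-1` (F k `*` G k)).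
  apply/seteqP; split=> // v _.
  have [i _ Fi] : (\bigcup_k F k) (uncons v).1 by rewrite -UF.
  have [j _ Gj] : (\bigcup_k G k) (uncons v).2 by rewrite -UG.
  exists (maxn i j) => //; split.
  - by move: Fi; apply/subsetPset/ndF/leq_maxl.
  - by move: Gj; apply/subsetPset/ndG/leq_maxr.
move=> k; have [mFk Fkoo] := mF k; have [mGk Gkoo] := mG k; split.
  rewrite -[X in measurable X]setTI; apply: muncons => //.
  exact: measurableX.
rewrite /lebesgue_rV_step /pushforward -comp_preimage.
rewrite (_ : uncons \o _ = id); last by apply/funext => u /=; rewrite consK.
by rewrite preimage_id product_measure1E// lte_mul_pinfty// ge0_fin_numE.
Qed.

HB.instance Definition _ := Measure_isSigmaFinite.Build _ _ _ lebesgue_rV_step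
  lebesgue_rV_step_sigma_finite.

End step.

(* Lebesgue measure on R^n, as the n-fold product of the one-dimensional one *)
Fixpoint lebesgue_rV n : {sigma_finite_measure set 'rV[R]_n -> \bar R} :=
  if n is n'.+1 then lebesgue_rV_step (lebesgue_rV n') else \d_(0 : 'rV[R]_0).

Lemma lebesgue_rV_box n (A : 'I_n -> set R) : (forall i, measurable (A i)) ->
  lebesgue_rV n [set v | forall i, A i (v ord0 i)]
    = (\prod_(i < n) lebesgue_measure (A i))%E.
Proof.
elim: n A => [|n IH] A mA.
  by rewrite big_ord0 /= diracE mem_set // => -[].
pose B := [set v : 'rV[R]_n | forall i, A (lift ord0 i) (v ord0 i)].
have mB : measurable B.
  have -> : B = \bigcap_(i in [set: 'I_n])
      ((fun v : 'rV[R]_n => v ord0 i) @^-1` A (lift ord0 i)).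
    by apply/seteqP; split=> v /= Bv i => [_|]; exact: Bv.
  apply: fin_bigcap_measurable => // i _.
  by rewrite -[X in measurable X]setTI; exact: measurable_coord_rV.
rewrite big_ord_recl -IH // -/B -product_measure1E //; last exact: mA.
congr (product_measure1 _ _ _); apply/seteqP; split=> [[a v]|[a v] [/= Aa Bv] i].
  move=> H; split=> [|i] /=; first by have := H ord0; rewrite cons_rV0.
  by have := H (lift ord0 i); rewrite cons_rVS.
by case: (unliftP ord0 i) => [j|] ->; rewrite ?cons_rVS ?cons_rV0 //; exact: Bv.
Qed.

End lebesgue_rV.

Section euclidean.
Context {R : realType} {d : nat}.
Implicit Types x y : 'rV[R]_d.

Definition dotp x y : R := \sum_(i < d) x ord0 i * y ord0 i.

(* The library norm on 'rV[R]_d is the sup norm. *)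
Definition enorm x : R := Num.sqrt (dotp x x).

End euclidean.

Section processes.
Context {R : realType} {dO : measure_display} {Omega : measurableType dO}.
Implicit Type P : probability Omega R.

Definition has_density P (d : nat) (Z : Omega -> 'rV[R]_d)
    (f : 'rV[R]_d -> \bar R) : Prop :=
  [/\ measurable_fun setT Z,
      measurable_fun setT f,
      (forall y, (0 <= f y)%E) &
      forall A, measurable A ->
        P (Z @^-1` A) = (\int[lebesgue_rV d]_(y in A) f y)%E].

(* [dZ s t] stands for the increment of a process between s and t. *)
Definition independent_increments P {dT} {T : measurableType dT}
    (dZ : R -> R -> Omega -> T) : Prop :=
  forall (n : nat) (u : R^nat) (A : (set T)^nat),
    0 <= u 0%N -> nondecreasing_seq u -> (forall i, measurable (A i)) ->
    P (\bigcap_(i < n) dZ (u i) (u i.+1) @^-1` A i)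
      = (\prod_(i < n) P (dZ (u i) (u i.+1) @^-1` A i))%E.

Definition process_sigma_algebra {dT} {T : measurableType dT}
    (Z : R -> Omega -> T) : set (set Omega) :=
  <<s \bigcup_(t in [set t | 0 <= t])
        preimage_set_system setT (Z t) measurable >>.

Definition independent_processes P {d1 d2}
    {T1 : measurableType d1} {T2 : measurableType d2}
    (Z1 : R -> Omega -> T1) (Z2 : R -> Omega -> T2) : Prop :=
  forall A B, process_sigma_algebra Z1 A -> process_sigma_algebra Z2 B ->
    P (A `&` B) = (P A * P B)%E.

Definition gauss_density (d : nat) (t : R) (y : 'rV[R]_d) : R :=
  (2 * pi * t) `^ (- (d%:R / 2)) * expR (- (enorm y ^+ 2 / (2 * t))).

(* Processes are indexed by all of R; only nonnegative times are meaningful. *)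
Record brownian_motion P (d : nat) (x : 'rV[R]_d)
    (Y : R -> Omega -> 'rV[R]_d) : Prop := {
  bm_measurable : forall t, 0 <= t -> measurable_fun setT (Y t) ;
  bm_start : {ae P, forall w, Y 0 w = x} ;
  bm_continuous : forall w, {within `[0, +oo[, continuous (fun t => Y t w)} ;
  bm_increments : independent_increments P (fun s t w => Y t w - Y s w) ;
  bm_gaussian : forall s t, 0 <= s < t ->
    has_density P (fun w => Y t w - Y s w)
      (fun y => (gauss_density (t - s) y)%:E) }.

Record poisson_process P (lambda : R) (N : R -> Omega -> nat) : Prop := {
  pp_measurable : forall t, 0 <= t -> measurable_fun setT (N t) ;
  pp_start : {ae P, forall w, N 0 w = 0%N} ;
  pp_nondecreasing : forall w s t, 0 <= s <= t -> (N s w <= N t w)%N ;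
  pp_right_continuous : forall w t, 0 <= t ->
    \forall s \near t^'+, N s w = N t w ;
  pp_increments : independent_increments P (fun s t w => (N t w - N s w)%N) ;
  pp_poisson : forall s t (k : nat), 0 <= s < t ->
    P [set w | (N t w - N s w)%N = k]
      = (poisson_pmf (lambda * (t - s)) k)%:E }.

(* T_n; equal to +oo when the n-th arrival never occurs. *)
Definition arrival (N : R -> Omega -> nat) (n : nat) (w : Omega) : \bar R :=
  ereal_inf [set t%:E | t in [set t | 0 <= t /\ (n <= N t w)%N]].

Definition total_resetting (d : nat) (Y : R -> Omega -> 'rV[R]_d)
    (N : R -> Omega -> nat) (X : R -> Omega -> 'rV[R]_d) : Prop :=
  forall t w, 0 <= t ->
    ((t%:E < arrival N 1 w)%E -> X t w = Y t w) /\
    (forall n, (1 <= n)%N ->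
      (arrival N n w <= t%:E)%E -> (t%:E < arrival N n.+1 w)%E ->
      X t w = Y t w - Y (fine (arrival N n w)) w).

End processes.

(* Extended-real valued because the integral diverges at y = 0 when 2 <= d. *)
Definition resetting_density {R : realType} {d : nat} (lambda t : R)
    (x y : 'rV[R]_d) : \bar R :=
  ((expR (- (lambda * t)) * gauss_density t (y - x))%:E +
   \int[lebesgue_measure]_(s in `[0%R, t])
     (lambda * expR (- (lambda * s)) * gauss_density s y)%:E)%E.

Section asymptotics.
Context {R : realType} {d : nat}.

(* t -> +oo and |y| -> +oo jointly *)
Definition joint_infty : set_system (R * 'rV[R]_d) :=
  filter_from setT (fun K : R => [set ty | K < ty.1 /\ K < enorm ty.2]).

Definition asymptotic_on (D : R -> 'rV[R]_d -> Prop)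
    (A B : R -> 'rV[R]_d -> R) : Prop :=
  (fun ty => A ty.1 ty.2 / B ty.1 ty.2)
    @ within [set ty | D ty.1 ty.2] joint_infty --> (1 : R).

End asymptotics.

(* Main.v *)
(* Write [a = sqrt (2 l)] and [r = |y|].  Since
     [l s + r^2 / (2 s) = a r + (a s - r)^2 / (2 s)],
   the change of variable [z = (a s - r) / sqrt s] turns the integral of
   [e^(- l s) p(s, y)] over [0, t] into [e^(- a r)] times an almost Gaussian
   integral over [z <= (a t - r) / sqrt t]: the Jacobian differs from its value
   at [z = 0] by a factor between [e^(- k |z|)] and [e^(k |z|)], where
   [k = O(1 / sqrt r)].  The upper limit tends to [+oo] when [t / r >= M > 1 / a]
   and is [0] when [t / r = 1 / a], whence the factor 1/2 in the critical case;
   in both cases the no-reset term is of relative order [1 / sqrt r].  When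
   [t / r <= M < 1 / a] the endpoint [s = t] dominates: dividing the integrand by
   the logarithmic derivative of its exponential part gives an antiderivative up
   to a relative error [O(1 / t)].  In all cases the integral is estimated by
   comparing the integrand with the derivative of an explicit function.

   For the existence of the density, let [U] be the time elapsed since the last
   reset before [t].  On [{N_t >= 1}], [U] has density [l e^(- l u)] on [[0, t]]
   and [X_t = Y_t - Y_(t - U)] with [U] independent of [Y]; Fubini's theorem for
   the law of [(Y, U)] gives the integral term. *)

Require Import Defs.
From HB Require Import structures.
From mathcomp Require Import all_boot all_order all_algebra.
From mathcomp Require Import all_classical all_reals all_analysis.
From mathcomp Require Import measurable_realfun.
From mathcomp Require Import ring lra.

Set Implicit Arguments.
Unset Strict Implicit.
Unset Printing Implicit Defensive.

Import Order.TTheory GRing.Theory Num.Theory.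
Import numFieldNormedType.Exports.

Local Open Scope classical_set_scope.
Local Open Scope ring_scope.

(** * Integrals of the resetting kernel *)

Section antiderivative_comparison.
Context {R : realType}.
Variables (F G dG : R -> R) (t : R).
Hypotheses (cF : forall s : R, 0 < s -> {for s, continuous F})
  (t0 : 0 < t)
  (dGE : forall s : R, 0 < s <= t -> is_derive s (1 : R) G (dG s)).
Local Notation mu := (@lebesgue_measure R).

Let cFw (e v : R) : 0 < e -> {within `[e, v], continuous F}.
Proof.
move=> e0; apply: continuous_in_subspaceT => s; rewrite inE /= in_itv /=.
by case/andP => es _; apply: cF; exact: lt_le_trans es.
Qed.

Let iF (e v : R) : 0 < e -> mu.-integrable `[e, v] (EFin \o F).
Proof.
move=> e0; apply: continuous_compact_integrable; first exact: segment_compact.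
exact: cFw.
Qed.

Let K (e s : R) : R := parameterized_integral mu e s F.

Let KE (e v : R) : 0 < e ->
  (\int[mu]_(s in `[e, v]) (F s)%:E = (K e v)%:E)%E.
Proof.
move=> e0; rewrite /K /parameterized_integral /Rintegral fineK //.
by apply: integrable_fin_num => //; exact: iF.
Qed.

Let Kee (e : R) : K e e = 0.
Proof. by rewrite /K /parameterized_integral set_itv1 Rintegral_set1. Qed.

Let dK (e s : R) : 0 < e -> e < s -> is_derive s (1 : R) (K e) (F s).
Proof.
move=> e0 es; have s1 : s < s + 1 by rewrite ltrDl.
have [] := continuous_FTC1_closed s1 (iF (s + 1) e0) es.
  by apply: cF; exact: lt_trans es.
by move=> df <-; rewrite derive1E; exact: DeriveDef.
Qed.

Let cK (e v : R) : 0 < e -> e <= v -> {within `[e, v], continuous K e}.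
Proof.
by move=> e0 ev; apply: parameterized_integral_continuous => //; exact: iF.
Qed.

Let cG (e : R) : 0 < e -> {within `[e, t], continuous G}.
Proof.
move=> e0; apply: continuous_in_subspaceT => s; rewrite inE /= in_itv /=.
case/andP => es st; apply: differentiable_continuous; apply/derivable1_diffP.
by have [] : is_derive s (1 : R) G (dG s) by apply: dGE; rewrite (lt_le_trans e0 es).
Qed.

Let mF : measurable_fun (`]0%R, +oo[ : set R) (EFin \o F).
Proof.
apply/measurable_EFinP; apply: open_continuous_measurable_fun.
  exact: interval_open.
by move=> s; rewrite inE /= in_itv /= andbT => /cF.
Qed.

(** [G] minus the primitive of [F] from [e] is nondecreasing, so the integral over [[e, t]] is at
    most [G t - G e <= G t]. Monotone convergence along [e = t / (n + 1)] handles the origin, where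
    [F] need not be continuous. *)
Lemma ge_int_antiderivative :
  (forall s : R, 0 < s <= t -> 0 <= F s) ->
  (forall s : R, 0 < s <= t -> F s <= dG s) ->
  (forall s : R, 0 < s <= t -> 0 <= G s) ->
  (\int[mu]_(s in `[0%R, t]) (F s)%:E <= (G t)%:E)%E.
Proof.
move=> F0 FdG G0.
have mF' e : 0 <= e -> measurable_fun `]e, t] (EFin \o F).
  move=> e0; apply: measurable_funS mF => //= s /=.
  by rewrite !in_itv /= andbT => /andP[/(le_lt_trans e0)].
rewrite -integral_itv_obnd_cbnd; last exact: mF'.
pose E n : set R := [set` `](t / n.+1%:R), t]].
have ndE : nondecreasing_seq E.
  move=> m n mn; apply/subsetPset => s; rewrite /E /= !in_itv /= => /andP[ms ->].
  rewrite andbT; apply: le_lt_trans ms.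
  by rewrite ler_pM2l// lef_pV2 ?posrE ?ltr0n// ler_nat.
have <- : \bigcup_n E n = `]0, t]%classic.
  apply/seteqP; split=> [s [n _]|s]; rewrite /E /= !in_itv /=.
    move=> /andP[ns ->]; rewrite andbT; apply: lt_trans ns.
    by rewrite divr_gt0.
  (* The index is chosen so that [t / s < n + 1]. *)
  move=> /andP[s0 st]; exists (Num.truncn (t / s)) => //=.
  rewrite in_itv /= st andbT ltr_pdivrMr// mulrC -ltr_pdivrMr//.
  exact: truncnS_gt.
have cv : (\int[mu]_(s in E n) (F s)%:E)%E @[n --> \oo] -->
    (\int[mu]_(s in \bigcup_n E n) (F s)%:E)%E.
  apply: ge0_nondecreasing_set_cvg_integral => //.
  - by move=> n; exact: measurable_itv.
  - by move=> n; apply: mF'; rewrite divr_ge0// ltW.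
  - move=> n s; rewrite /E /= in_itv /= => /andP[ns st]; rewrite lee_fin F0// st.
    by rewrite andbT (lt_trans _ ns)// divr_gt0.
apply: (cvge_le _ cv).
apply: nearW => n; have e0 : 0 < t / n.+1%:R by rewrite divr_gt0.
have et : t / n.+1%:R <= t by rewrite ler_piMr ?(ltW t0)// invf_le1 ?ltr0n// ler1n.
set e := t / _ in e0 et; rewrite /E -/e.
rewrite integral_itv_obnd_cbnd; last by apply: mF'; exact: ltW.
rewrite KE// lee_fin.
suff : (G - K e) e <= (G - K e) t.
  rewrite /= !fctE Kee; have := G0 e; rewrite e0 et => /(_ isT).
  lra.
have dGK s : s \in `]e, t[ -> is_derive s (1 : R) (G - K e) (dG s - F s).
  rewrite in_itv /= => /andP[es st].
  have := dK e0 es; suff : is_derive s (1 : R) G (dG s) by move=> *; exact: is_deriveB.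
  by apply: dGE; rewrite (lt_trans e0 es) ltW.
apply: (@ger0_derive1_ndecr _ _ e t) => //.
- by move=> s /dGK[].
- move=> s /[dup] /dGK[_]; rewrite derive1E => ->.
  rewrite in_itv /= => /andP[es st]; rewrite subr_ge0 FdG//.
  by rewrite (lt_trans e0 es) ltW.
- by move=> s; apply: cvgB; [exact: cG|exact: cK].
Qed.

(** Here the primitive minus [G] is nondecreasing, and a single cut-off [e] with [G e <= z] bounds
    [G t] by [z] plus the integral over [[e, t]]. *)
Lemma le_int_antiderivative :
  (forall s : R, 0 < s <= t -> 0 <= F s) ->
  (forall s : R, 0 < s <= t -> dG s <= F s) ->
  (forall z : R, 0 < z -> exists2 s, 0 < s <= t & G s <= z) ->
  ((G t)%:E <= \int[mu]_(s in `[0%R, t]) (F s)%:E)%E.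
Proof.
move=> F0 FdG G0.
apply/lee_addgt0Pr => z z0; have [e /andP[e0 et] Ge] := G0 z z0.
have mFt : measurable_fun `]0, t] (EFin \o F).
  apply: measurable_funS mF => //= s /=.
  by rewrite !in_itv /= andbT => /andP[].
rewrite -integral_itv_obnd_cbnd//.
apply: (@le_trans _ _ (\int[mu]_(s in `[e, t]) (F s)%:E + z%:E)%E); last first.
  rewrite leeD2r// ge0_subset_integral//.
  by move=> s /=; rewrite !in_itv /= => /andP[es ->]; rewrite andbT (lt_le_trans e0).
rewrite KE// -EFinD lee_fin.
suff : (K e - G) e <= (K e - G) t by rewrite /= !fctE Kee; lra.
have dGK s : s \in `]e, t[ -> is_derive s (1 : R) (K e - G) (F s - dG s).
  rewrite in_itv /= => /andP[es st].
  have := dK e0 es; suff : is_derive s (1 : R) G (dG s) by move=> *; exact: is_deriveB.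
  by apply: dGE; rewrite (lt_trans e0 es) ltW.
apply: (@ger0_derive1_ndecr _ _ e t) => //.
- by move=> s /dGK[].
- move=> s /[dup] /dGK[_]; rewrite derive1E => ->.
  rewrite in_itv /= => /andP[es st]; rewrite subr_ge0 FdG//.
  by rewrite (lt_trans e0 es) ltW.
- by move=> s; apply: cvgB; [exact: cK|exact: cG].
Qed.

End antiderivative_comparison.

(** * The standard normal distribution function *)

Section normal_cdf.
Context {R : realType}.
Local Notation mu := (@lebesgue_measure R).

Definition normal_cdf (z : R) : R :=
  \int[mu]_(x in `]-oo, z]) normal_pdf 0 1 x.

Lemma std_normal_pdfE (z : R) :
  normal_pdf 0 1 z = expR (- (z ^+ 2 / 2)) / Num.sqrt (2 * pi).
Proof.
rewrite normal_pdfE ?oner_neq0// /normal_peak /normal_fun subr0 expr1n mulNr.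
by rewrite mul1r mulr_natl mulrC.
Qed.

Let ipdf (D : set (measurableTypeR R)) : measurable D ->
  mu.-integrable D (EFin \o normal_pdf 0 1).
Proof.
move=> mD.
exact: (integrableS measurableT mD (@subsetT _ _)
  (integrable_normal_pdf 0 1)).
Qed.

Lemma is_derive_normal_cdf (z : R) :
  is_derive z (1 : R) normal_cdf (normal_pdf 0 1 z).
Proof.
have z1 : z < z + 1 by rewrite ltrDl.
have [] := continuous_FTC1 z1 (ipdf (measurable_itv `]-oo, (z + 1)])).
- exact: ltNyr.
- exact: (continuous_normal_pdf (oner_neq0 R)).
by move=> df <-; rewrite derive1E; exact: DeriveDef.
Qed.

Let normal_cdfE (z : R) :
  (normal_cdf z)%:E = normal_prob 0 1 (`]-oo, z]%classic : set R).
Proof.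
rewrite /normal_cdf /Rintegral fineK//; apply: integrable_fin_num => //.
exact: ipdf.
Qed.

Lemma normal_cdf_ge0 (z : R) : 0 <= normal_cdf z.
Proof. by apply: Rintegral_ge0 => x _; exact: normal_pdf_ge0. Qed.

Lemma normal_cdf_le1 (z : R) : normal_cdf z <= 1.
Proof. by rewrite -lee_fin normal_cdfE; exact: probability_le1. Qed.

Lemma normal_cdf_nondecreasing : nondecreasing_fun normal_cdf.
Proof.
move=> u v uv; rewrite -lee_fin !normal_cdfE le_measure ?inE//.
exact: subitvPr.
Qed.

(** The identity, seen as a random variable under the standard normal law, has [normal_cdf] as its
    distribution function; the general limits of distribution functions then apply. *)
Let idTR : measurableTypeR R -> R := idfun.

#[local] HB.instance Definition _ :=
  @isMeasurableFun.Build _ _ _ _ idTR (@measurable_id _ _ setT).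

Let X : {RV (normal_prob 0 1 : probability (measurableTypeR R) R) >-> R} := idTR.

Let cdf_normalE : cdf X = EFin \o normal_cdf.
Proof. by apply/funext => z; rewrite /= normal_cdfE. Qed.

Lemma normal_cdf_cvgy : normal_cdf z @[z --> +oo] --> (1 : R).
Proof. by have := cvg_cdfy1 X; rewrite cdf_normalE => /fine_cvg. Qed.

Lemma normal_cdf_cvgNy : normal_cdf z @[z --> -oo] --> (0 : R).
Proof. by have := cvg_cdfNy0 X; rewrite cdf_normalE => /fine_cvg. Qed.

(** The substitution [x -> - x] identifies the two halves of the total mass 1 of the even
    density. *)
Lemma normal_cdf0 : normal_cdf 0 = 2^-1.
Proof.
have := @integral_normal_pdf R 0 1.
rewrite ge0_symfun_integralT; last 3 first.
- by move=> x; exact: normal_pdf_ge0.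
- exact: (continuous_normal_pdf (oner_neq0 R)).
- by move=> x /=; rewrite !std_normal_pdfE sqrrN.
rewrite -set_itvcy ge0_integration_by_substitution0//; last 2 first.
- by apply/measurable_EFinP; exact: measurable_normal_pdf.
- by move=> x; rewrite lee_fin; exact: normal_pdf_ge0.
under eq_integral do rewrite std_normal_pdfE sqrrN -std_normal_pdfE.
have -> : (\int[mu]_(x in `]-oo, 0%R]) (normal_pdf 0 1 x)%:E = (normal_cdf 0)%:E)%E.
  by rewrite normal_cdfE.
by rewrite -EFinM => /eqP; rewrite eqe => /eqP h; lra.
Qed.

End normal_cdf.

(** * The integrand of the resetting term *)

Section resetting_kernel.
Context {R : realType}.
Implicit Types (d : nat) (l r s : R).

(** This is [e^(- l s) p(s, y)] with [r = |y|]: the transition density of Brownian motion killed at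
    rate [l]. *)
Definition killed_gauss d l r s : R :=
  expR (- (l * s)) * ((2 * pi * s) `^ (- (d%:R / 2)) * expR (- (r ^+ 2 / (2 * s)))).

Lemma killed_gauss_gt0 d l r s : 0 < s -> 0 < killed_gauss d l r s.
Proof.
move=> s0; rewrite /killed_gauss !mulr_gt0 ?expR_gt0// powR_gt0//.
by rewrite !mulr_gt0// pi_gt0.
Qed.

Lemma is_derive_killed_gauss d l r s : 0 < s ->
  is_derive s (1 : R) (killed_gauss d l r)
    (killed_gauss d l r s * (- l - d%:R / (2 * s) + r ^+ 2 / (2 * s ^+ 2))).
Proof.
move=> s0; have c0 : 0 < 2 * pi * s by rewrite !mulr_gt0// pi_gt0.
have s0' : s != 0 by rewrite gt_eqF.
have pi0 : (pi : R) != 0 by rewrite gt_eqF ?pi_gt0.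
have d1 : is_derive s (1 : R) (fun s : R => expR (- (l * s))) (expR (- (l * s)) * - l).
  have h : is_derive s (1 : R) (fun s : R => - (l * s)) (- l).
    by apply: is_derive_eq; rewrite /GRing.scale /=; ring.
  by apply: (is_derive_eq (is_derive1_comp _ _)); ring.
have d2 : is_derive s (1 : R) (fun s : R => (2 * pi * s) `^ (- (d%:R / 2)))
    ((2 * pi * s) `^ (- (d%:R / 2)) * (- d%:R / (2 * s))).
  have h : is_derive s (1 : R) (fun s : R => 2 * pi * s) (2 * pi).
    by apply: is_derive_eq; rewrite /GRing.scale /=; ring.
  have := is_derive1_powR (- (d%:R / 2)) c0 => h2.
  apply: (is_derive_eq (is_derive1_comp h2 h)).
  have -> : (2 * pi * s) `^ (- (d%:R / 2) - 1) =
      (2 * pi * s) `^ (- (d%:R / 2)) / (2 * pi * s).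
    by rewrite -[X in _ = _ / X]powRr1 ?(ltW c0)// -powRN -powRD// (gt_eqF c0) implybT.
  by move: (pi : R) pi0 => p p0; field; rewrite s0' p0.
have d3 : is_derive s (1 : R) (fun s : R => expR (- (r ^+ 2 / (2 * s))))
    (expR (- (r ^+ 2 / (2 * s))) * (r ^+ 2 / (2 * s ^+ 2))).
  have h : is_derive s (1 : R) (fun s : R => (2 * s)) 2.
    by apply: is_derive_eq; rewrite /GRing.scale /=; ring.
  have h1 : is_derive s (1 : R) (fun s : R => (2 * s)^-1) (- (2 * s) ^- 2 * 2).
    by apply: is_deriveV; rewrite mulf_neq0.
  have h2 : is_derive s (1 : R) (fun s : R => - (r ^+ 2 / (2 * s))) (r ^+ 2 / (2 * s ^+ 2)).
    by apply: is_derive_eq; rewrite /GRing.scale /=; field.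
  by apply: (is_derive_eq (is_derive1_comp _ _)); ring.
apply: is_derive_eq; rewrite /GRing.scale /=.
by rewrite /killed_gauss; ring.
Qed.
End resetting_kernel.

(** * Bounds on the integral through a Gaussian change of variable *)

Section renewal_kernel_bounds.
Context {R : realType}.
Local Notation mu := (@lebesgue_measure R).

(** For [q > 1], use [q <= 1 + (q - q^-1)] and [1 + u <= e^u]. Applied to [q] and to [q^-1], the
    bound confines both to [[e^(- m), e^m]] with [m = |q - q^-1|]. *)
Lemma le_expR_norm_subV (q : R) : 0 < q -> q <= expR `|q - q^-1|.
Proof.
move=> q0; have [q1|q1] := leP q 1.
  by rewrite (le_trans q1)// -[leLHS]expR0 ler_expR.
apply: le_trans (expR_ge1Dx _).
have q1' : q^-1 < 1 by rewrite invf_lt1.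
by rewrite ger0_norm; lra.
Qed.

(* With [q = sqrt s / b], the middle term is [ds/dz * s^(- d/2)] at [s = b^2]
   divided by its value at [s]. *)
Lemma jacobian_ratio_bounds (d : nat) (q : R) : 0 < q ->
  expR (- (d.+3%:R * `|q - q^-1|)) <= (q + q^-1) / 2 * q ^+ d / q ^+ 2
    <= expR (d.+3%:R * `|q - q^-1|).
Proof.
move=> q0; have qV0 : 0 < q^-1 by rewrite invr_gt0.
pose m : R := `|q - q^-1|; rewrite -/m; have qm : q <= expR m := le_expR_norm_subV q0.
have qVm : q^-1 <= expR m.
  by have := le_expR_norm_subV qV0; rewrite invrK distrC.
have mq : expR (- m) <= q by rewrite expRN -[leRHS]invrK lef_pV2 ?posrE ?expR_gt0.
have mqV : expR (- m) <= q^-1 by rewrite expRN lef_pV2 ?posrE ?expR_gt0.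
have E0 := expR_gt0 m; have E0' := expR_gt0 (- m).
(* [d + 3 = 1 + d + 2]: one power of [e^m] for the mean of [q] and [q^-1], [d] powers for [q^d], two
   for [q^-2]. *)
rewrite -mulrN; have mE (x : R) : expR (d.+3%:R * x) = expR x * expR x ^+ d * (expR x) ^+ 2.
  by rewrite expRM_natl -exprS -exprD addn2.
rewrite !mE -exprVn; apply/andP; split; apply: ler_pM.
- by rewrite mulr_ge0 ?exprn_ge0 ?expR_ge0.
- by rewrite exprn_ge0 ?expR_ge0.
- apply: ler_pM; rewrite ?exprn_ge0 ?expR_ge0//; first lra.
  by rewrite lerXn2r ?nnegrE ?expR_ge0// ltW.
- by rewrite lerXn2r ?nnegrE ?expR_ge0// ltW.
- by rewrite mulr_ge0 ?exprn_ge0 ?ltW//; lra.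
- by rewrite exprn_ge0 ?ltW.
- apply: ler_pM; rewrite ?exprn_ge0 ?expR_ge0 ?(ltW q0)//; [lra|lra|].
  by rewrite lerXn2r ?nnegrE ?expR_ge0// ltW.
- by rewrite lerXn2r ?nnegrE ?expR_ge0// ltW.
Qed.

Variables (d : nat) (a b : R).
Hypotheses (a0 : 0 < a) (b0 : 0 < b).

(* For [l = a^2 / 2] and [r = a b^2], the exponent [l s + r^2 / (2 s)] equals
   [(a b)^2 + (gauss_coord s)^2 / 2], and [renewal_const] is the kernel times
   [ds/dz] at [s = b^2], where [gauss_coord] vanishes. *)
Definition gauss_coord (s : R) : R := (a * s - a * b ^+ 2) / Num.sqrt s.

Definition renewal_const : R :=
  (2 * pi) `^ (- (d%:R / 2)) * expR (- (a * b) ^+ 2) * (b / b ^+ d) / a.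

Let k := killed_gauss d (a ^+ 2 / 2) (a * b ^+ 2).
Let z := gauss_coord.
Let dz (s : R) := a * (s + b ^+ 2) / (2 * s * Num.sqrt s).
(** As [z = a b (q - q^-1)] for [q = sqrt s / b], the exponent [(d + 3) |q - q^-1|] equals [e |z|].
    Since [a b = sqrt (a r)], [e] is of order [1 / sqrt r]. *)
Let e := d.+3%:R / (a * b).

Let e0 : 0 < e. Proof. by rewrite divr_gt0// mulr_gt0. Qed.

Let dzE (s : R) : 0 < s -> is_derive s (1 : R) z (dz s).
Proof.
move=> s0; have h := is_derive1_sqrt s0.
have q0 : Num.sqrt s != 0 by rewrite gt_eqF// sqrtr_gt0.
have h1 : is_derive s (1 : R) (fun s => (Num.sqrt s)^-1) _ := is_deriveV q0 h.
have h2 : is_derive s (1 : R) (fun s => a * s - a * b ^+ 2) a.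
  by apply: is_derive_eq; rewrite /GRing.scale /=; ring.
apply: is_derive_eq; rewrite /GRing.scale /= /dz.
by move: (Num.sqrt s) q0 (sqr_sqrtr (ltW s0)) => q q0 <-; field.
Qed.

(** The weight [w] is the Jacobian ratio at [q = sqrt s / b]. Its bound [e^(e |z|)] is relaxed by
    [|z| <= (1 + z^2) / 2], so that it only changes the variance and the constant of the Gaussian
    factor. *)
Let kE (s : R) : 0 < s -> exists2 w : R,
  k s * w = renewal_const * expR (- (z s ^+ 2 / 2)) * dz s &
  expR (- (e / 2 * (1 + z s ^+ 2))) <= w <= expR (e / 2 * (1 + z s ^+ 2)).
Proof.
move=> s0; pose q := Num.sqrt s / b.
have p0 : Num.sqrt s != 0 by rewrite gt_eqF// sqrtr_gt0.
have q0 : 0 < q by rewrite divr_gt0// sqrtr_gt0.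
have a1 : a != 0 by rewrite gt_eqF.
have b1 : b != 0 by rewrite gt_eqF.
have zq : z s = a * b * (q - q^-1).
  rewrite /z /gauss_coord /q.
  by move: (Num.sqrt s) p0 (sqr_sqrtr (ltW s0)) => p p0 <-; field; rewrite p0 b1.
exists ((q + q^-1) / 2 * q ^+ d / q ^+ 2).
  rewrite /k /killed_gauss /renewal_const /dz.
  rewrite powRM ?(ltW s0) ?mulr_ge0 ?pi_ge0//.
  have -> : s `^ (- (d%:R / 2)) = (Num.sqrt s ^+ d)^-1.
    by rewrite powRN mulrC powRrM powR12_sqrt ?(ltW s0)// powR_mulrn ?sqrtr_ge0.
  have expE : expR (- (a ^+ 2 / 2 * s)) * expR (- ((a * b ^+ 2) ^+ 2 / (2 * s)))
      = expR (- (a * b) ^+ 2) * expR (- (z s ^+ 2 / 2)).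
    rewrite -!expRD zq /q; congr expR.
    by move: (Num.sqrt s) p0 (sqr_sqrtr (ltW s0)) => p p0 <-; field; rewrite p0 b1.
  transitivity ((2 * pi) `^ (- (d%:R / 2))
      * (expR (- (a * b) ^+ 2) * expR (- (z s ^+ 2 / 2)))
      * ((Num.sqrt s ^+ d)^-1 * ((q + q^-1) / 2 * q ^+ d / q ^+ 2))).
    by rewrite -expE; ring.
  suff -> : (Num.sqrt s ^+ d)^-1 * ((q + q^-1) / 2 * q ^+ d / q ^+ 2)
      = b / b ^+ d / a * (a * (s + b ^+ 2) / (2 * s * Num.sqrt s)) by ring.
  rewrite /q; move: (Num.sqrt s) p0 (sqr_sqrtr (ltW s0)) => p p0 <-.
  rewrite (expr_div_n _ _ d).
  have pd0 : p ^+ d != 0 by rewrite expf_neq0.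
  have bd0 : b ^+ d != 0 by rewrite expf_neq0.
  by move: (p ^+ d) (b ^+ d) pd0 bd0 => P B P0 B0; field; rewrite ?P0 ?B0 ?p0 ?b1 ?a1.
have ab0 : 0 < a * b by rewrite mulr_gt0.
have le : d.+3%:R * `|q - q^-1| <= e / 2 * (1 + z s ^+ 2).
  have -> : d.+3%:R * `|q - q^-1| = e * `|z s|.
    rewrite zq normrM (gtr0_norm ab0) /e.
    by move: (a * b) ab0 => c c0; field; rewrite gt_eqF.
  rewrite -mulrA ler_pM2l// -(real_normK (num_real (z s))).
  by have := sqr_ge0 (`|z s| - 1); nra.
have /andP[h1 h2] := jacobian_ratio_bounds d q0.
by rewrite (le_trans _ h1) ?(le_trans h2) ?ler_expR ?lerN2.
Qed.

Let C0 : 0 < renewal_const.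
Proof.
rewrite /renewal_const divr_gt0// mulr_gt0 ?divr_gt0 ?exprn_gt0// mulr_gt0 ?expR_gt0//.
by rewrite powR_gt0// mulr_gt0// pi_gt0.
Qed.

Let dz0 (s : R) : 0 < s -> 0 <= dz s.
Proof.
move=> s0; rewrite divr_ge0 ?mulr_ge0 ?sqrtr_ge0 ?addr_ge0 ?sqr_ge0//; exact: ltW.
Qed.

Let ck (s : R) : 0 < s -> {for s, continuous k}.
Proof.
move=> s0; apply: differentiable_continuous; apply/derivable1_diffP.
by have [] := is_derive_killed_gauss d (a ^+ 2 / 2) (a * b ^+ 2) s0.
Qed.

(** A normal distribution function in [z], of variance [1 / c] and scaled by [e^v]. The upper bound
    takes [c = 1 - e] and [v = e / 2]; the lower one takes [c = 1 + e] and [v = - e / 2]. *)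
Let G (c v s : R) : R :=
  renewal_const * Num.sqrt (2 * pi) * expR v / Num.sqrt c * normal_cdf (Num.sqrt c * z s).

Let dGE (c v s : R) : 0 < c -> 0 < s -> is_derive s (1 : R) (G c v)
  (renewal_const * expR v * expR (- (c * z s ^+ 2 / 2)) * dz s).
Proof.
move=> c0 s0; have h := dzE s0.
have q0 : Num.sqrt c != 0 by rewrite gt_eqF// sqrtr_gt0.
have p0 : Num.sqrt (2 * pi) != 0 :> R by rewrite gt_eqF// sqrtr_gt0 mulr_gt0// pi_gt0.
have h1 : is_derive s (1 : R) (fun s => Num.sqrt c * z s) (Num.sqrt c * dz s).
  by apply: is_derive_eq; rewrite /GRing.scale /=; ring.
have h2 := @is_derive1_comp _ normal_cdf (fun s => Num.sqrt c * z s) s _ _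
  (is_derive_normal_cdf (Num.sqrt c * z s)) h1.
have h3 := @is_deriveZ _ _ _ _
  (renewal_const * Num.sqrt (2 * pi) * expR v / Num.sqrt c) _ _ _ h2.
apply: (is_derive_eq h3).
rewrite /GRing.scale /= std_normal_pdfE exprMn sqr_sqrtr ?(ltW c0)//.
by move: (Num.sqrt c) (Num.sqrt (2 * pi)) q0 p0 => q p q0 p0; field; rewrite q0 p0.
Qed.

Lemma ge_int_killed_gauss (t : R) : 0 < t -> e < 1 ->
  (\int[mu]_(s in `[0%R, t]) (k s)%:E <=
   (renewal_const * Num.sqrt (2 * pi) * expR (e / 2) / Num.sqrt (1 - e)
     * normal_cdf (Num.sqrt (1 - e) * gauss_coord t))%:E)%E.
Proof.
move=> t0 e1; have c0 : 0 < 1 - e by rewrite subr_gt0.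
apply: (ge_int_antiderivative ck t0 (fun s st => dGE (e / 2) c0 (proj1 (andP st)))) => //.
- by move=> s /andP[s0 _]; rewrite ltW// killed_gauss_gt0.
- move=> s /andP[s0 _]; have [w kw /andP[w1 w2]] := kE s0.
  have w0 : 0 < w by rewrite (lt_le_trans _ w1)// expR_gt0.
  have -> : k s = k s * w / w by rewrite mulfK// gt_eqF.
  rewrite kw -mulrA (mulrC (dz s)) mulrA ler_wpM2r ?dz0//.
  rewrite -[leLHS]mulrA -[leRHS]mulrA ler_pM2l//.
  rewrite ler_pdivrMr// -expRD (le_trans _ (ler_wpM2l (expR_ge0 _) w1))//.
  by rewrite -expRD ler_expR; lra.
- move=> s /andP[s0 _]; rewrite mulr_ge0 ?normal_cdf_ge0// divr_ge0 ?sqrtr_ge0//.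
  by rewrite mulr_ge0 ?expR_ge0// mulr_ge0 ?sqrtr_ge0// ltW.
Qed.

Lemma le_int_killed_gauss (t : R) : 0 < t ->
  ((renewal_const * Num.sqrt (2 * pi) * expR (- (e / 2)) / Num.sqrt (1 + e)
     * normal_cdf (Num.sqrt (1 + e) * gauss_coord t))%:E
   <= \int[mu]_(s in `[0%R, t]) (k s)%:E)%E.
Proof.
move=> t0; have c0 : 0 < 1 + e by rewrite addr_gt0.
apply: (le_int_antiderivative ck (fun s st => dGE (- (e / 2)) c0 (proj1 (andP st)))) => //.
- by move=> s /andP[s0 _]; rewrite ltW// killed_gauss_gt0.
- move=> s /andP[s0 _]; have [w kw /andP[w1 w2]] := kE s0.
  have w0 : 0 < w by rewrite (lt_le_trans _ w1)// expR_gt0.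
  have -> : k s = k s * w / w by rewrite mulfK// gt_eqF.
  rewrite kw -[leRHS]mulrA (mulrC (dz s)) [leRHS]mulrA ler_wpM2r ?dz0//.
  rewrite -[leLHS]mulrA -[leRHS]mulrA ler_pM2l//.
  rewrite ler_pdivlMr// -expRD (le_trans (ler_wpM2l (expR_ge0 _) w2))//.
  by rewrite -expRD ler_expR; lra.
- move=> v v0.
  set A : R := renewal_const * Num.sqrt (2 * pi) * expR (- (e / 2)) / Num.sqrt (1 + e).
  have A0 : 0 < A.
    by rewrite divr_gt0 ?sqrtr_gt0// mulr_gt0 ?expR_gt0// mulr_gt0// sqrtr_gt0 mulr_gt0// pi_gt0.
  have : \forall x \near (-oo : set_system R), normal_cdf x < v / A.
    by apply: (cvgr_lt (0 : R) normal_cdf_cvgNy); rewrite divr_gt0.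
  move=> [Z [_ hZ]].
  have cZ : 0 < 1 + `|Z| by rewrite ltr_wpDr.
  (* [p <= b^2 / 2] makes the numerator of [z p] at most [- a b^2 / 2]; the bound on [sqrt p] then
     gives [z p <= - (1 + |Z|)], below the threshold [Z] under which [normal_cdf] is small
     enough. *)
  pose p : R := Num.min (Num.min (b ^+ 2 / 2) t) ((a * b ^+ 2 / 2 / (1 + `|Z|)) ^+ 2).
  have p0 : 0 < p by rewrite !lt_min t0 exprn_gt0 ?divr_gt0 ?mulr_gt0 ?exprn_gt0.
  have pb : p <= b ^+ 2 / 2 by rewrite !ge_min lexx.
  have pt : p <= t by rewrite !ge_min lexx orbT.
  have pZ : Num.sqrt p <= a * b ^+ 2 / 2 / (1 + `|Z|).
    rewrite -[leRHS]ger0_norm; last by rewrite !divr_ge0 ?mulr_ge0 ?sqr_ge0 ?(ltW a0) ?ltW.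
    by rewrite -sqrtr_sqr ler_wsqrtr// !ge_min lexx orbT.
  exists p; first by rewrite p0.
  rewrite /G -/A mulrC -ler_pdivlMr// ltW//; apply: hZ.
  have sp : 0 < Num.sqrt p by rewrite sqrtr_gt0.
  have zp : z p <= - (1 + `|Z|).
    rewrite /z /gauss_coord ler_pdivrMr//.
    move: pZ; rewrite ler_pdivlMr// => pZ.
    have := ler_wpM2l (ltW a0) pb; nra.
  have c1 : 1 <= Num.sqrt (1 + e) by rewrite -[leLHS]sqrtr1 ler_wsqrtr// lerDl ltW.
  have : - `|Z| <= Z by rewrite lerNl ler_normr lexx orbT.
  by nra.
Qed.

End renewal_kernel_bounds.

(** * Bounds on the integral when the endpoint [s = t] dominates *)

Section endpoint_kernel_bounds.
Context {R : realType}.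
Local Notation mu := (@lebesgue_measure R).
Variables (d : nat) (l r t delta : R).
Hypotheses (l0 : 0 < l) (r0 : 0 < r) (t0 : 0 < t) (delta0 : 0 < delta).
Hypothesis tr : delta * r ^+ 2 <= r ^+ 2 - 2 * l * t ^+ 2.

Let k := killed_gauss d l r.
Let c (s : R) : R := 2 * s ^+ 2 / (r ^+ 2 - 2 * l * s ^+ 2).
Let eta : R := (4 / delta ^+ 2 + d%:R / delta) * (t / r ^+ 2).
Let u (s : R) : R := 4 * s * r ^+ 2 / (r ^+ 2 - 2 * l * s ^+ 2) ^+ 2
  - d%:R * s / (r ^+ 2 - 2 * l * s ^+ 2).

Let r2 : 0 < r ^+ 2. Proof. exact: exprn_gt0. Qed.

(** [r^2 - 2 l s^2] decreases in [s], so the distance to the critical ratio assumed at [t] persists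
    at all earlier times. *)
Let D_ge (s : R) : 0 < s <= t -> delta * r ^+ 2 <= r ^+ 2 - 2 * l * s ^+ 2.
Proof.
move=> /andP[s0 st]; apply: le_trans tr _; rewrite lerD2l lerN2 ler_wpM2l//.
  by rewrite mulr_ge0// ltW.
by rewrite lerXn2r ?nnegrE// ltW.
Qed.

Let D_gt0 (s : R) : 0 < s <= t -> 0 < r ^+ 2 - 2 * l * s ^+ 2.
Proof. by move=> /D_ge; apply: lt_le_trans; rewrite mulr_gt0. Qed.

(** [u] is a difference of two nonnegative terms; bounding their denominators below through [D_ge]
    turns each into one summand of [eta]. *)
Let u_bound (s : R) : 0 < s <= t -> - eta <= u s <= eta.
Proof.
move=> st; have /andP[s0 s1] := st; have D0 := D_gt0 st.
have dr : 0 < delta * r ^+ 2 by rewrite mulr_gt0.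
have h1 : 0 <= d%:R * s / (r ^+ 2 - 2 * l * s ^+ 2) <= d%:R / delta * (t / r ^+ 2).
  rewrite divr_ge0 ?mulr_ge0 ?(ltW s0) ?(ltW D0)//=.
  rewrite mulf_div ler_pM ?mulr_ge0 ?(ltW s0) ?invr_ge0 ?(ltW D0)//.
    by rewrite ler_wpM2l.
  by rewrite lef_pV2 ?posrE// D_ge.
have h2 : 0 <= 4 * s * r ^+ 2 / (r ^+ 2 - 2 * l * s ^+ 2) ^+ 2
    <= 4 / delta ^+ 2 * (t / r ^+ 2).
  rewrite divr_ge0 ?sqr_ge0 ?mulr_ge0 ?(ltW s0) ?(ltW r0)//=.
  have -> : 4 / delta ^+ 2 * (t / r ^+ 2) = 4 * t * r ^+ 2 / (delta * r ^+ 2) ^+ 2.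
    by field; rewrite !gt_eqF.
  apply: ler_pM; rewrite ?mulr_ge0 ?invr_ge0 ?sqr_ge0 ?(ltW s0) ?(ltW r0)//.
    by rewrite ler_pM2r// ler_wpM2l.
  by rewrite lef_pV2 ?posrE ?exprn_gt0// lerXn2r ?nnegrE ?(ltW dr) ?(ltW D0)// D_ge.
by rewrite /u /eta mulrDl; lra.
Qed.

Let c_ge0 (s : R) : 0 < s <= t -> 0 <= c s.
Proof. by move=> st; rewrite /c divr_ge0 ?(ltW (D_gt0 st))// mulr_ge0// sqr_ge0. Qed.

Let ck (s : R) : 0 < s -> {for s, continuous k}.
Proof.
move=> s0; apply: differentiable_continuous; apply/derivable1_diffP.
by have [] := is_derive_killed_gauss d l r s0.
Qed.

(* [c] is the inverse of the derivative of [- (l s + r^2 / (2 s))], so that [c k]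
   has derivative [k] up to the relative error [u = O(t / r^2)]. *)
Let dGE (v s : R) : 0 < s <= t ->
  is_derive s (1 : R) (fun s => c s * k s / v) (k s * (1 + u s) / v).
Proof.
move=> st; have /andP[s0 s1] := st; have D0 := D_gt0 st.
have h := is_derive_killed_gauss d l r s0; rewrite -/k in h.
have h1 : is_derive s (1 : R) (fun s => r ^+ 2 - 2 * l * s ^+ 2) (- (4 * l * s)).
  by apply: is_derive_eq; rewrite /GRing.scale /=; ring.
have h2 := @is_deriveV _ (fun s => r ^+ 2 - 2 * l * s ^+ 2) _ _ _ (lt0r_neq0 D0) h1.
have h3 : is_derive s (1 : R) (fun s => 2 * s ^+ 2) (4 * s).
  by apply: is_derive_eq; rewrite /GRing.scale /=; ring.
have h4 : is_derive s (1 : R) c _ := is_deriveM h3 h2.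
have h5 := is_deriveM h4 h.
have h6 : is_derive s (1 : R) (fun s => v^-1 * (c s * k s)) _ := is_deriveZ v^-1 h5.
rewrite (_ : (fun _ => _) = (fun s => v^-1 * (c s * k s))); last first.
  by apply/funext => x; rewrite mulrC.
apply: (is_derive_eq h6); rewrite /GRing.scale /= /u /c.
move: (v^-1) (gt_eqF s0) (gt_eqF D0) => w s0f D0f.
by field; rewrite ?s0f ?D0f.
Qed.

(** Dividing [c k] by [1 - eta] compensates the relative error: [(1 + u) / (1 - eta) >= 1]. *)
Lemma ge_int_killed_gauss_endpoint : eta < 1 ->
  (\int[mu]_(s in `[0%R, t]) (k s)%:E <=
   (2 * t ^+ 2 / (r ^+ 2 - 2 * l * t ^+ 2) * k t / (1 - eta))%:E)%E.
Proof.
move=> eta1; have v0 : 0 < 1 - eta by rewrite subr_gt0.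
apply: (ge_int_antiderivative ck t0 (dGE (1 - eta))).
- by move=> s /andP[s0 _]; rewrite ltW// killed_gauss_gt0.
- move=> s st; have /andP[s0 _] := st; have /andP[u1 u2] := u_bound st.
  rewrite ler_pdivlMr// ler_pM2l ?killed_gauss_gt0//; lra.
- move=> s st; have /andP[s0 _] := st.
  rewrite divr_ge0 ?(ltW v0)// mulr_ge0 ?(ltW (killed_gauss_gt0 _ _ _ s0))//.
  exact: c_ge0.
Qed.

(** [e^(- r^2 / (2 s))] offsets the singularity of [s^(- d / 2)] at 0. For [m = d > 0] the bound is
    the [m]-th power of [e^(- y^2 / 2) / sqrt s <= sqrt m / r], where [y = r / sqrt (s m)], which
    follows from [1 + y^2 / 2 >= y]. *)
Let k_bounded : exists2 B : R, 0 < B & forall s : R, 0 < s -> k s <= B.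
Proof.
(* Dimension 0 is split off because [m] is a divisor below. *)
case: d @k ck dGE => [|n] kk _ _.
  exists 1 => // s s0; rewrite /kk /killed_gauss mul0r oppr0 powRr0 mul1r -expRD.
  rewrite -[leRHS]expR0 ler_expR -opprD oppr_le0.
  by rewrite addr_ge0// ?divr_ge0 ?sqr_ge0 ?mulr_ge0 ?(ltW s0) ?(ltW l0).
have [m mE m0] : exists2 m : R, m = n.+1%:R & 0 < m.
  by exists n.+1%:R => //; rewrite ltr0n.
have m1 := gt_eqF m0.
pose B1 := Num.sqrt m / r.
exists ((2 * pi) `^ (- (m / 2)) * B1 ^+ n.+1).
  by rewrite mulr_gt0 ?powR_gt0 ?mulr_gt0 ?pi_gt0// exprn_gt0// divr_gt0// sqrtr_gt0 m0.
move=> s s0; have sp : 0 < Num.sqrt s by rewrite sqrtr_gt0.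
rewrite /kk /killed_gauss -mE powRM ?(ltW s0) ?mulr_ge0 ?pi_ge0//.
have -> : s `^ (- (m / 2)) = (Num.sqrt s)^-1 ^+ n.+1.
  by rewrite powRN mulrC powRrM powR12_sqrt ?(ltW s0)// mE powR_mulrn ?sqrtr_ge0// exprVn.
have -> : expR (- (r ^+ 2 / (2 * s))) = (expR (- (r ^+ 2 / (2 * s) / m))) ^+ n.+1.
  by rewrite -expRM_natl -mE; congr expR; field; rewrite (gt_eqF s0) m1.
rewrite -[leRHS]mul1r.
rewrite ler_pM ?expR_ge0 ?mulr_ge0 ?powR_ge0 ?exprn_ge0 ?expR_ge0 ?invr_ge0 ?sqrtr_ge0//.
  by rewrite -[leRHS]expR0 ler_expR oppr_le0 mulr_ge0 ?(ltW s0) ?(ltW l0).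
rewrite -mulrA ler_wpM2l ?powR_ge0// -exprMn lerXn2r ?nnegrE//.
  by rewrite divr_ge0 ?sqrtr_ge0 ?(ltW r0).
have sm : 0 < Num.sqrt m by rewrite sqrtr_gt0.
rewrite expRN -invfM -[leRHS]invrK lef_pV2 ?posrE ?mulr_gt0 ?expR_gt0 ?invr_gt0 ?divr_gt0//.
rewrite /B1 invf_div.
apply: le_trans (ler_wpM2l (ltW sp) (expR_ge1Dx _)).
have -> : r ^+ 2 / (2 * s) / m = (r / (Num.sqrt s * Num.sqrt m)) ^+ 2 / 2.
  by rewrite expr_div_n exprMn !sqr_sqrtr ?(ltW s0) ?(ltW m0)//; field; rewrite (gt_eqF s0) m1.
rewrite (_ : r / Num.sqrt m = Num.sqrt s * (r / (Num.sqrt s * Num.sqrt m))); last first.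
  by field; rewrite !gt_eqF.
rewrite ler_pM2l//; set y : R := r / _; have := sqr_ge0 (y - 1); nra.
Qed.

Lemma le_int_killed_gauss_endpoint :
  ((2 * t ^+ 2 / (r ^+ 2 - 2 * l * t ^+ 2) * k t / (1 + eta))%:E <=
   \int[mu]_(s in `[0%R, t]) (k s)%:E)%E.
Proof.
have eta0 : 0 <= eta.
  by rewrite mulr_ge0 ?addr_ge0 ?divr_ge0 ?sqr_ge0 ?(ltW delta0) ?(ltW t0).
have v0 : 0 < 1 + eta by rewrite ltr_wpDr.
apply: (le_int_antiderivative ck (dGE (1 + eta))).
- by move=> s /andP[s0 _]; rewrite ltW// killed_gauss_gt0.
- move=> s st; have /andP[s0 _] := st; have /andP[u1 u2] := u_bound st.
  rewrite ler_pdivrMr// ler_pM2l ?killed_gauss_gt0//; lra.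
- move=> z z0; have [B B0 kB] := k_bounded.
  (* [c s <= 2 t s / (delta r^2)] and [k s <= B], so [c s k s <= A s], which is at most [z] once
     [s <= z / A]. *)
  pose A : R := 2 * t / (delta * r ^+ 2) * B.
  have A0 : 0 < A by rewrite mulr_gt0// divr_gt0 ?mulr_gt0.
  pose s := Num.min t (z / A).
  have s0 : 0 < s by rewrite lt_min t0 divr_gt0.
  have st : 0 < s <= t by rewrite s0 ge_min lexx.
  exists s => //; have sz : s <= z / A by rewrite ge_min lexx orbT.
  have ks := ltW (killed_gauss_gt0 d l r s0).
  have cs := c_ge0 st.
  apply: (@le_trans _ _ (c s * k s)).
    have ck0 : 0 <= c s * k s by exact: mulr_ge0.
    by rewrite ler_pdivrMr// ler_peMr// lerDl.
  move: sz; rewrite ler_pdivlMr//; apply: le_trans.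
  have csB : c s <= s * (2 * t / (delta * r ^+ 2)).
    rewrite /c [leRHS]mulrA; apply: ler_pM.
    - by rewrite mulr_ge0// sqr_ge0.
    - by rewrite invr_ge0 ltW// D_gt0.
    - by rewrite expr2 mulrCA ler_pM2l// ler_pM2l//; case/andP: st.
    - by rewrite lef_pV2 ?posrE ?D_gt0 ?mulr_gt0// D_ge.
  by rewrite /A [leRHS]mulrA; apply: ler_pM => //; exact: kB.
Qed.

End endpoint_kernel_bounds.

(** * Asymptotics *)

Section joint_limits.
Context {R : realType} {d : nat}.
Implicit Types D : set (R * 'rV[R]_d).

#[global] Instance joint_infty_filter : Filter (@joint_infty R d).
Proof.
apply: filter_from_filter; first by exists 0.
move=> K L _ _; exists (Num.max K L) => // ty /=.
by rewrite !gt_max => -[/andP[? ?] /andP[? ?]].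
Qed.

Lemma near_joint_infty D (K : R) (P : R * 'rV[R]_d -> Prop) :
  (forall t y, K < t -> K < enorm y -> D (t, y) -> P (t, y)) ->
  \forall ty \near within D joint_infty, P ty.
Proof. by move=> H; exists K => // -[t y] [/= tK yK] Dty; exact: H. Qed.

Lemma cvg_joint_infty_time D : ty.1 @[ty --> within D joint_infty] --> +oo.
Proof.
apply/cvgryPge => A; apply: (@near_joint_infty _ A) => t y /= At _ _; exact: ltW.
Qed.

Lemma cvg_joint_infty_space D :
  enorm ty.2 @[ty --> within D joint_infty] --> +oo.
Proof.
apply/cvgryPge => A; apply: (@near_joint_infty _ A) => t y /= _ At _; exact: ltW.
Qed.

Lemma cvg_inv_sqrt_pinfty : (Num.sqrt u)^-1 @[u --> +oo] --> (0 : R).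
Proof.
apply/cvgr0Pnorm_le => e e0.
exists (e ^- 2); split; first by rewrite num_real.
move=> u eu; rewrite ger0_norm ?invr_ge0 ?sqrtr_ge0//.
have u0 : 0 < u by apply: lt_trans eu; rewrite invr_gt0 exprn_gt0.
rewrite -[leRHS]invrK lef_pV2 ?posrE ?sqrtr_gt0 ?invr_gt0//.
rewrite -[leLHS]ger0_norm ?invr_ge0 ?(ltW e0)// -sqrtr_sqr ler_wsqrtr//.
by rewrite exprVn (ltW eu).
Qed.

Lemma cvg_sqrt_pinfty (c : R) : 0 < c -> c * Num.sqrt u @[u --> +oo] --> +oo.
Proof.
move=> c0; apply/cvgryPge => A; exists ((A / c) ^+ 2); split; first by rewrite num_real.
move=> u Au; rewrite mulrC -ler_pdivrMr//.
by rewrite (le_trans (ler_norm _))// -sqrtr_sqr ler_wsqrtr// ltW.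
Qed.

End joint_limits.

(** The inverse is rewritten as [u (u^2)^(- 1)] with a real power; both sides vanish at [u = 0]. *)
Lemma measurable_invr {R : realType} : measurable_fun [set: R] (@GRing.inv R).
Proof.
rewrite (_ : @GRing.inv R = fun u => u * (u ^+ 2) `^ (-1)).
  apply: measurable_funM => //.
  by apply: (measurableT_comp (measurable_powR _)); exact: exprn_measurable.
apply/funext => u; have [->|u0] := eqVneq u 0; first by rewrite mul0r invr0.
rewrite powRN powRr1 ?sqr_ge0// expr2 invfM mulrA divff// mul1r//.
Qed.

(** * Bounds on the density and value of the leading constant *)

Section resetting_asymptotics.
Context {R : realType}.
Local Notation mu := (@lebesgue_measure R).
Implicit Types (d : nat) (l t : R).

Lemma measurable_killed_gauss d l r : measurable_fun setT (killed_gauss d l r).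
Proof.
apply: measurable_funM.
  by apply: measurableT_comp => //; apply: measurableT_comp => //; exact: measurable_funM.
apply: measurable_funM.
  by apply: (measurableT_comp (measurable_powR _)); exact: measurable_funM.
apply: measurableT_comp => //; apply: measurableT_comp => //; apply: measurable_funM => //.
by apply: (measurableT_comp measurable_invr); exact: measurable_funM.
Qed.

Lemma killed_gauss_ge0 d l r s : 0 <= killed_gauss d l r s :> R.
Proof. by rewrite mulr_ge0 ?expR_ge0// mulr_ge0 ?powR_ge0 ?expR_ge0. Qed.

Lemma resetting_densityE d l t (x y : 'rV[R]_d) : 0 <= l ->
  resetting_density l t x y =
  ((expR (- (l * t)) * gauss_density t (y - x))%:E +
   l%:E * \int[mu]_(s in `[0%R, t]) (killed_gauss d l (enorm y) s)%:E)%E.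
Proof.
move=> l0; congr (_ + _)%E; rewrite -ge0_integralZl_EFin//.
- by apply: eq_integral => s _; rewrite -EFinM -[in LHS]mulrA.
- by move=> s _; rewrite lee_fin killed_gauss_ge0.
- by apply/measurable_EFinP; apply: measurable_funTS; exact: measurable_killed_gauss.
Qed.

(** Finite bounds on both sides force the integral to be finite, so [fine] does not fall back to its
    default value 0. *)
Lemma fine_resetting_density_bounds d l t (x y : 'rV[R]_d) (lo hi : R) : 0 <= l ->
  (lo%:E <= \int[mu]_(s in `[0%R, t]) (killed_gauss d l (enorm y) s)%:E <= hi%:E)%E ->
  expR (- (l * t)) * gauss_density t (y - x) + l * lo
    <= fine (resetting_density l t x y)
    <= expR (- (l * t)) * gauss_density t (y - x) + l * hi.
Proof.
move=> l0; rewrite resetting_densityE//.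
case: (\int[mu]_(s in _) _)%E => [I| |] //=; rewrite ?leeNy_eq ?leye_eq// ?andbF//.
by rewrite !lee_fin => /andP[h1 h2]; rewrite !lerD2l !ler_wpM2l.
Qed.

Lemma enorm_ge0 d (y : 'rV[R]_d) : 0 <= enorm y.
Proof. exact: sqrtr_ge0. Qed.

Lemma dotp_ge0 d (y : 'rV[R]_d) : 0 <= dotp y y.
Proof. by apply: sumr_ge0 => i _; rewrite -expr2 sqr_ge0. Qed.

Lemma sqr_enorm d (y : 'rV[R]_d) : enorm y ^+ 2 = dotp y y.
Proof. by rewrite sqr_sqrtr// dotp_ge0. Qed.

Lemma sqr_enormB d (x y : 'rV[R]_d) :
  enorm (y - x) ^+ 2 = enorm y ^+ 2 - 2 * dotp x y + enorm x ^+ 2.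
Proof.
rewrite !sqr_enorm /dotp mulr_sumr -sumrB -big_split /=; apply: eq_bigr => i _.
by rewrite !mxE; ring.
Qed.

(** A Cauchy-Schwarz inequality with the [l^1] norm of [x]; only the linear growth in [|y|]
    matters. *)
Lemma dotp_le d (x y : 'rV[R]_d) :
  dotp x y <= (\sum_(i < d) `|x ord0 i|) * enorm y.
Proof.
rewrite mulr_suml; apply: ler_sum => i _.
rewrite (le_trans (ler_norm _))// normrM ler_wpM2l//.
rewrite -sqrtr_sqr ler_wsqrtr// /dotp (bigD1 i)//= -expr2 lerDl.
by apply: sumr_ge0 => j _; rewrite -expr2 sqr_ge0.
Qed.

(** With [b^2 = r / a], [l] times the total Gaussian mass is exactly the claimed leading term. Every
    positive quantity is written as the exponential of its logarithm, which leaves a polynomial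
    identity between exponents. *)
Lemma renewal_constE d l r : 0 < l -> 0 < r ->
  let a := Num.sqrt (2 * l) in
  l * (renewal_const d a (Num.sqrt (r / a)) * Num.sqrt (2 * pi)) =
  l `^ ((d%:R + 1) / 4) / (2 `^ ((d%:R + 1) / 4) * pi `^ ((d%:R - 1) / 2))
    * (expR (- (a * r)) / r `^ ((d%:R - 1) / 2)).
Proof.
move=> l0 r0 /=; rewrite /renewal_const.
have a0 : 0 < Num.sqrt (2 * l) by rewrite sqrtr_gt0 mulr_gt0.
have -> : (Num.sqrt (2 * l) * Num.sqrt (r / Num.sqrt (2 * l))) ^+ 2 = Num.sqrt (2 * l) * r.
  rewrite exprMn (@sqr_sqrtr _ (r / _)) ?divr_ge0 ?(ltW r0) ?(ltW a0)// expr2.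
  by field; rewrite gt_eqF.
move: (expR (- (_ * r))) => E.
have expP (u : R) : 0 < u -> exists v, u = expR v.
  by move=> u0; exists (ln u); rewrite lnK.
have sqrtE (u : R) : Num.sqrt (expR u) = expR (u / 2).
  rewrite [X in expR X](_ : u = u / 2 + u / 2); last by field.
  by rewrite expRD -expr2 sqrtr_sqr ger0_norm ?expR_ge0.
have powE (u v : R) : expR u `^ v = expR (u * v) by rewrite -expRM.
have [v2 E2] := expP 2 (ltr0n _ _).
have [vp Ep] := expP pi (pi_gt0 R).
have [vl El] := expP _ l0.
have [vr Er] := expP _ r0.
have -> : Num.sqrt (r / Num.sqrt (2 * l)) = expR ((vr - (v2 + vl) / 2) / 2).
  by rewrite [in LHS]E2 El Er -expRD sqrtE -expRN -expRD sqrtE.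
have -> : Num.sqrt (2 * l) = expR ((v2 + vl) / 2) by rewrite [in LHS]E2 El -expRD sqrtE.
have -> : Num.sqrt (2 * pi) = expR ((v2 + vp) / 2) :> R.
  by rewrite [in LHS]E2 Ep -expRD sqrtE.
have -> p : (2 * pi) `^ p = expR ((v2 + vp) * p) :> R.
  by rewrite [X in (X * _) `^ _]E2 Ep -expRD powE.
have -> p : 2 `^ p = expR (v2 * p) by rewrite [in LHS]E2 powE.
have -> p : pi `^ p = expR (vp * p) :> R by rewrite Ep powE.
rewrite El Er !powE -expRM_natl.
rewrite -!expRN -!expRD mulrA -!expRN -!expRD.
rewrite (_ : _ * _ = E * expR (vl + ((v2 + vp) * (- (d%:R / 2))
  + ((vr - (v2 + vl) / 2) / 2 - d%:R * ((vr - (v2 + vl) / 2) / 2))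
  - (v2 + vl) / 2 + (v2 + vp) / 2))); last first.
  by rewrite !expRD; ring.
rewrite mulrCA [RHS](_ : _ = E * expR (vl * ((d%:R + 1) / 4)
  + - (v2 * ((d%:R + 1) / 4) + vp * ((d%:R - 1) / 2)) - vr * ((d%:R - 1) / 2))); last first.
  by rewrite !expRD; ring.
by congr (_ * expR _); field.
Qed.

End resetting_asymptotics.

(** * The three asymptotic regimes *)

Section resetting_limits.
Context {R : realType}.
Local Notation mu := (@lebesgue_measure R).
Variables (d : nat) (l : R) (x : 'rV[R]_d).
Hypothesis l0 : 0 < l.

Let a := Num.sqrt (2 * l).
Let a0 : 0 < a. Proof. by rewrite sqrtr_gt0 mulr_gt0. Qed.
Let a2 : a ^+ 2 / 2 = l.
Proof. by rewrite sqr_sqrtr ?mulr_ge0 ?(ltW l0)//; field. Qed.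

Let B (r : R) : R :=
  l `^ ((d%:R + 1) / 4) / (2 `^ ((d%:R + 1) / 4) * pi `^ ((d%:R - 1) / 2))
  * (expR (- (a * r)) / r `^ ((d%:R - 1) / 2)).

Let cB : R :=
  l `^ ((d%:R + 1) / 4) / (2 `^ ((d%:R + 1) / 4) * pi `^ ((d%:R - 1) / 2)).

Let cB0 : 0 < cB.
Proof. by rewrite divr_gt0 ?powR_gt0 ?mulr_gt0 ?powR_gt0 ?pi_gt0. Qed.

Let B_gt0 r : 0 < r -> 0 < B r.
Proof. by move=> r0; rewrite mulr_gt0// divr_gt0 ?expR_gt0 ?powR_gt0. Qed.

Let T (t : R) (y : 'rV[R]_d) : R := expR (- (l * t)) * gauss_density t (y - x).

Let A (t : R) (y : 'rV[R]_d) : R := fine (resetting_density l t x y).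

Let K (M : R) : R :=
  expR ((\sum_(i < d) `|x ord0 i|) / M) * (2 * pi * M) `^ (- (d%:R / 2)) / cB.

(** Completing the square gives [l t + r^2 / (2 t) >= a r], the cross term [<x, y> / t] is at most
    [S / M], and [t >= M r] bounds [t^(- d / 2)]. Compared with [r^(- (d - 1) / 2)], this leaves
    [1 / sqrt r]. *)
Let no_reset_bound (M t : R) (y : 'rV[R]_d) : 0 < M -> 0 < t -> 0 < enorm y ->
  M <= t / enorm y -> T t y / B (enorm y) <= K M * (Num.sqrt (enorm y))^-1.
Proof.
set r := enorm y; set S := \sum_(i < d) `|x ord0 i|.
move=> M0 t0 r0; rewrite ler_pdivlMr// => Mt.
have S0 : 0 <= S by exact: sumr_ge0.
rewrite ler_pdivrMr ?B_gt0//.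
have -> : K M / Num.sqrt r * B r =
    expR (- (a * r) + S / M) * (2 * pi * (M * r)) `^ (- (d%:R / 2)).
  rewrite /K -/S /B -/cB expRD (mulrA (2 * pi)).
  rewrite (powRM _ (mulr_ge0 (mulr_ge0 _ (pi_ge0 R)) (ltW M0)) (ltW r0))//.
  have -> : r `^ (- (d%:R / 2)) = (Num.sqrt r)^-1 / r `^ ((d%:R - 1) / 2).
    rewrite -powR12_sqrt ?(ltW r0)// -!powRN -powRD; last by rewrite (gt_eqF r0) implybT.
    by congr (_ `^ _); field.
  have alg (u v w i j E : R) : w != 0 ->
      u * v / w * i * (w * (E * j)) = E * u * (v * (i * j)).
    by move=> w0; field.
  by apply: alg; exact: lt0r_neq0.
rewrite /T /gauss_density mulrCA mulrC -expRD.
apply: ler_pM; rewrite ?expR_ge0 ?powR_ge0//.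
  rewrite ler_expR sqr_enormB -/r.
  have h1 : dotp x y / t <= S / M.
    rewrite ler_pdivrMr// mulrAC ler_pdivlMr//.
    apply: (@le_trans _ _ (S * r * M)); first by rewrite ler_pM2r//; exact: dotp_le.
    by rewrite -mulrA ler_wpM2l// mulrC.
  have h2 : a * r <= l * t + r ^+ 2 / (2 * t).
    rewrite -subr_ge0 -a2.
    have -> : a ^+ 2 / 2 * t + r ^+ 2 / (2 * t) - a * r = (a * t - r) ^+ 2 / (2 * t).
      by field; rewrite gt_eqF.
    by rewrite divr_ge0 ?sqr_ge0 ?mulr_ge0 ?(ltW t0).
  have h3 : 0 <= enorm x ^+ 2 / (2 * t) by rewrite divr_ge0 ?sqr_ge0 ?mulr_ge0 ?(ltW t0).
  have -> : - (l * t) - (r ^+ 2 - 2 * dotp x y + enorm x ^+ 2) / (2 * t)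
    = - (l * t + r ^+ 2 / (2 * t)) + dotp x y / t - enorm x ^+ 2 / (2 * t).
    by field; rewrite gt_eqF.
  by lra.
rewrite !powRN lef_pV2 ?posrE ?powR_gt0 ?mulr_gt0 ?pi_gt0//.
rewrite ge0_ler_powR ?nnegrE ?divr_ge0 ?mulr_ge0 ?pi_ge0 ?(ltW t0) ?(ltW M0) ?(ltW r0)//.
by rewrite ler_pM2l// mulr_gt0// pi_gt0.
Qed.

Let T_ge0 t y : 0 <= T t y.
Proof. by rewrite mulr_ge0 ?expR_ge0// mulr_ge0 ?powR_ge0 ?expR_ge0. Qed.

Section fixed_domain.
Variable D : set (R * 'rV[R]_d).
Local Notation W := (within D joint_infty).

Let g_cvg : (Num.sqrt (enorm ty.2))^-1 @[ty --> W] --> (0 : R).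
Proof. exact: cvg_comp (@cvg_joint_infty_space R d D) cvg_inv_sqrt_pinfty. Qed.

Let no_reset_cvg0 (M : R) : 0 < M -> (forall t y, D (t, y) -> M <= t / enorm y) ->
  T ty.1 ty.2 / B (enorm ty.2) @[ty --> W] --> (0 : R).
Proof.
move=> M0 DM.
apply: (@squeeze_cvgr _ _ _ _ (fun=> 0) (fun ty => K M * (Num.sqrt (enorm ty.2))^-1)).
- apply: (@near_joint_infty _ _ _ 0) => t y /= t0 r0 Dty.
  by rewrite no_reset_bound ?DM// andbT divr_ge0// ltW// B_gt0.
- exact: cvg_cst.
- by rewrite -[X in _ --> X](mulr0 (K M)); apply: cvgM => //; exact: cvg_cst.
Qed.

(** The error parameter of the Gaussian bounds for [b = sqrt (r / a)]. *)
Let kappa (ty : R * 'rV[R]_d) : R := d.+3%:R / (a * Num.sqrt (enorm ty.2 / a)).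

Let kappa_cvg : kappa ty @[ty --> W] --> (0 : R).
Proof.
rewrite (_ : kappa = fun ty => d.+3%:R / (a * Num.sqrt a^-1) * (Num.sqrt (enorm ty.2))^-1).
  rewrite -[X in _ --> X](mulr0 (d.+3%:R / (a * Num.sqrt a^-1))).
  by apply: cvgM => //; exact: cvg_cst.
apply/funext => ty; rewrite /kappa sqrtrM ?enorm_ge0//.
by rewrite -[RHS]mulrA -invfM; congr (_ / _); ring.
Qed.

(** [corr kappa] and [corr (- kappa)] are the correction factors of the upper and the lower Gaussian
    bound. *)
Let corr (u : R) : R := expR (u / 2) / Num.sqrt (1 - u).

Let corr_cvg (f : R * 'rV[R]_d -> R) : f ty @[ty --> W] --> (0 : R) ->
  corr (f ty) @[ty --> W] --> (1 : R).
Proof.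
move=> f0; have c1 : corr 0 = 1 by rewrite /corr mul0r expR0 subr0 sqrtr1 divr1.
rewrite -[X in _ --> X]c1.
apply: (cvg_comp _ _ f0); apply: cvgM.
  apply: (cvg_comp (fun u : R => u / 2) expR); last exact: continuous_expR.
  by apply: cvgM; [exact: cvg_id|exact: cvg_cst].
apply: cvgV; first by rewrite subr0 sqrtr1 oner_neq0.
apply: (cvg_comp (fun u : R => 1 - u) Num.sqrt); last exact: sqrt_continuous.
by apply: cvgB; [exact: cvg_cst|exact: cvg_id].
Qed.

Let z (ty : R * 'rV[R]_d) : R := gauss_coord a (Num.sqrt (enorm ty.2 / a)) ty.1.

(** Division by [B = l C sqrt (2 pi)], with [C] the renewal constant, leaves a correction factor
    close to 1 times the normal distribution function at a rescaled [z]. *)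
Let sandwich ty : 0 < ty.1 -> 0 < enorm ty.2 -> kappa ty < 1 ->
  T ty.1 ty.2 / B (enorm ty.2) 
    + corr (- kappa ty) * normal_cdf (Num.sqrt (1 + kappa ty) * z ty)
   <= A ty.1 ty.2 / B (enorm ty.2) <=
  T ty.1 ty.2 / B (enorm ty.2) 
    + corr (kappa ty) * normal_cdf (Num.sqrt (1 - kappa ty) * z ty).
Proof.
case: ty => t y /= t0 r0 k1.
have b0 : 0 < Num.sqrt (enorm y / a) by rewrite sqrtr_gt0 divr_gt0.
have rE : a * Num.sqrt (enorm y / a) ^+ 2 = enorm y.
  by rewrite sqr_sqrtr ?divr_ge0 ?enorm_ge0 ?(ltW a0)// mulrC divfK// gt_eqF.
have h1 := le_int_killed_gauss d a0 b0 t0.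
have h2 := ge_int_killed_gauss a0 b0 t0 k1.
have BE := renewal_constE d l0 r0; rewrite /= -/a -/(B _) in BE.
have := @fine_resetting_density_bounds _ d l t x y _ _ (ltW l0) (introT andP (conj _ _)).
rewrite -{1 2}a2 -{1 2}rE => /(_ _ _ h1 h2).
rewrite -/(T t y) -/(A t y) => /andP[g1 g2].
have E u v : (T t y / B (enorm y) + u * v) * B (enorm y) = T t y + u * v * B (enorm y).
  by rewrite mulrDl divfK// gt_eqF// B_gt0.
rewrite ler_pdivlMr ?B_gt0// ler_pdivrMr ?B_gt0// !E -BE /corr /z /= mulNr opprK.
apply/andP; split.
  apply: le_trans g1; rewrite lerD2l le_eqVlt; apply/orP; left.
  by apply/eqP; rewrite /kappa /=; ring.
apply: le_trans g2 _; rewrite lerD2l le_eqVlt; apply/orP; left.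
by apply/eqP; rewrite /kappa /=; ring.
Qed.

(** [z >= (a - 1 / M) sqrt t] tends to infinity, so the distribution function in the lower bound
    tends to 1; in the upper bound it is at most 1. *)
Lemma resetting_density_beyond_critical (M : R) : a^-1 < M ->
  (forall t y, D (t, y) -> M <= t / enorm y) ->
  A ty.1 ty.2 / B (enorm ty.2) @[ty --> W] --> (1 : R).
Proof.
move=> aM DM; have M0 : 0 < M by rewrite (lt_trans _ aM)// invr_gt0.
have c0 : 0 < a - M^-1 by rewrite subr_gt0 -[ltRHS]invrK ltf_pV2 ?posrE ?invr_gt0.
apply: (@squeeze_cvgr _ _ _ _
  (fun ty => corr (- kappa ty) * normal_cdf ((a - M^-1) * Num.sqrt ty.1))
  (fun ty => T ty.1 ty.2 / B (enorm ty.2) + corr (kappa ty))).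
- near=> ty.
  have [t0 [r0 Dty]] : 0 < ty.1 /\ 0 < enorm ty.2 /\ D ty.
    by near: ty; apply: (@near_joint_infty _ _ _ 0) => t y t0 r0.
  have k1 : kappa ty < 1 by near: ty; exact: cvgr_lt kappa_cvg _ ltr01.
  have k0 : 0 <= kappa ty by rewrite divr_ge0 ?mulr_ge0 ?sqrtr_ge0 ?(ltW a0).
  have corr0 u : 0 <= corr u by rewrite divr_ge0 ?expR_ge0 ?sqrtr_ge0.
  have /andP[h1 h2] := sandwich t0 r0 k1; apply/andP; split.
    apply: le_trans h1; apply: ler_wpDl; first by rewrite divr_ge0// ltW// B_gt0.
    rewrite ler_wpM2l//; apply: normal_cdf_nondecreasing.
    have sk : 1 <= Num.sqrt (1 + kappa ty) by rewrite -[leLHS]sqrtr1 ler_wsqrtr// lerDl.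
    have st : 0 < Num.sqrt ty.1 by rewrite sqrtr_gt0.
    have zt : (a - M^-1) * Num.sqrt ty.1 <= z ty.
      rewrite /z /gauss_coord ler_pdivlMr// -mulrA -expr2 sqr_sqrtr ?(ltW t0)//.
      rewrite sqr_sqrtr ?divr_ge0 ?enorm_ge0 ?(ltW a0)// [a * (_ / a)]mulrC divfK ?gt_eqF//.
      have := DM ty.1 ty.2; rewrite -surjective_pairing => /(_ Dty).
      rewrite ler_pdivlMr// -ler_pdivlMl// => h; rewrite mulrBl lerD2l lerN2//.
    apply: (le_trans zt); rewrite ler_peMl//; apply: (le_trans _ zt).
    by rewrite mulr_ge0 ?sqrtr_ge0 ?(ltW c0).
  apply: le_trans h2 _; rewrite lerD2l ler_piMr//; exact: normal_cdf_le1.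
- rewrite -[X in _ --> X](mulr1 1); apply: cvgM.
    by apply: corr_cvg; rewrite -oppr0; exact: cvgN.
  apply: (cvg_comp _ _ _ normal_cdf_cvgy).
  exact: cvg_comp (@cvg_joint_infty_time R d D) (cvg_sqrt_pinfty c0).
- rewrite -[X in _ --> X](add0r 1); apply: cvgD; last exact: corr_cvg.
  exact: no_reset_cvg0 M0 DM.
Unshelve. all: by end_near. Qed.

(** Here [z = 0], whatever the factor [sqrt (1 +- kappa)], so both bounds carry exactly
    [normal_cdf 0 = 1 / 2]. *)
Lemma resetting_density_at_critical : (forall t y, D (t, y) -> t / enorm y = a^-1) ->
  A ty.1 ty.2 / (B (enorm ty.2) / 2) @[ty --> W] --> (1 : R).
Proof.
move=> DM; have M0 : 0 < a^-1 by rewrite invr_gt0.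
have TB : T ty.1 ty.2 / B (enorm ty.2) @[ty --> W] --> (0 : R).
  by apply: no_reset_cvg0 M0 _ => t y /DM ->.
apply: (@squeeze_cvgr _ _ _ _
  (fun ty => 2 * (T ty.1 ty.2 / B (enorm ty.2)) + corr (- kappa ty))
  (fun ty => 2 * (T ty.1 ty.2 / B (enorm ty.2)) + corr (kappa ty))).
- near=> ty.
  have [t0 [r0 Dty]] : 0 < ty.1 /\ 0 < enorm ty.2 /\ D ty.
    by near: ty; apply: (@near_joint_infty _ _ _ 0) => t y t0 r0.
  have k1 : kappa ty < 1 by near: ty; exact: cvgr_lt kappa_cvg _ ltr01.
  have zt : z ty = 0.
    rewrite /z /gauss_coord sqr_sqrtr ?divr_ge0 ?enorm_ge0 ?(ltW a0)//.
    have := DM ty.1 ty.2; rewrite -surjective_pairing => /(_ Dty) h.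
    have -> : ty.1 = enorm ty.2 / a by rewrite -h mulrC divfK// gt_eqF.
    by rewrite subrr mul0r.
  have := sandwich t0 r0 k1; rewrite zt !mulr0 normal_cdf0.
  have -> : A ty.1 ty.2 / (B (enorm ty.2) / 2) = 2 * (A ty.1 ty.2 / B (enorm ty.2)).
    by field; rewrite gt_eqF// B_gt0.
  by move=> /andP[h1 h2]; apply/andP; split; lra.
- rewrite -[X in _ --> X](add0r 1); apply: cvgD.
    by rewrite -[X in _ --> X](mulr0 2); apply: cvgM => //; exact: cvg_cst.
  by apply: corr_cvg; rewrite -oppr0; exact: cvgN.
- rewrite -[X in _ --> X](add0r 1); apply: cvgD; last exact: corr_cvg.
  by rewrite -[X in _ --> X](mulr0 2); apply: cvgM => //; exact: cvg_cst.
Unshelve. all: by end_near. Qed.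

(** The no-reset term is known exactly, the reset term up to [(1 +- eta)^-1]. Since
    [(1 + eta)^-1 <= 1 <= (1 - eta)^-1], the same factors bound the sum of the two. *)
Lemma resetting_density_below_critical (M : R) : 0 < M -> M < a^-1 ->
  (forall t y, D (t, y) -> t / enorm y <= M) ->
  A ty.1 ty.2 / (expR (- (l * ty.1)) * gauss_density ty.1 ty.2 *
     (2 * l / ((enorm ty.2 / ty.1) ^+ 2 - 2 * l)
      + expR ((- enorm x ^+ 2 + 2 * dotp x ty.2) / (2 * ty.1)))) @[ty --> W] --> (1 : R).
Proof.
(* From [t <= M r] follows [r^2 - 2 l t^2 >= (1 - 2 l M^2) r^2]; [delta] is positive because
   [a M < 1]. *)
move=> M0 Ma DM; pose delta := 1 - 2 * l * M ^+ 2.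
have delta0 : 0 < delta.
  rewrite subr_gt0; have <- : a ^+ 2 = 2 * l by rewrite sqr_sqrtr// mulr_ge0// ltW.
  rewrite -exprMn -[ltRHS](expr1n _ 2) ltrXn2r// ?nnegrE ?mulr_ge0 ?(ltW a0) ?(ltW M0)//.
  by rewrite mulrC -ltr_pdivlMr// mul1r.
pose c := 4 / delta ^+ 2 + d%:R / delta.
have c0 : 0 < c by rewrite ltr_pwDl ?divr_ge0 ?divr_gt0 ?exprn_gt0 ?(ltW delta0).
pose eta (ty : R * 'rV[R]_d) : R := c * (ty.1 / enorm ty.2 ^+ 2).
(* [t / r <= M] gives [eta <= c M / r], and [1 / r] is the square of [1 / sqrt r], which tends to 0
   by [g_cvg]. *)
have eta_cvg : eta ty @[ty --> W] --> (0 : R).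
  apply: (@squeeze_cvgr _ _ _ _ (fun=> 0)
    (fun ty => c * M * ((Num.sqrt (enorm ty.2))^-1 * (Num.sqrt (enorm ty.2))^-1))).
  - apply: (@near_joint_infty _ _ _ 0) => t y /= t0 r0 Dty.
    rewrite /eta /= mulr_ge0 ?(ltW c0) ?divr_ge0 ?sqr_ge0 ?(ltW t0)//=.
    have -> : (Num.sqrt (enorm y))^-1 / Num.sqrt (enorm y) = (enorm y)^-1.
      by rewrite -{3}(sqr_sqrtr (enorm_ge0 y)) expr2 invfM.
    have -> : t / enorm y ^+ 2 = t / enorm y / enorm y by rewrite expr2 invfM mulrA.
    rewrite -[leRHS]mulrA ler_pM2l//.
    by rewrite ler_pM2r ?invr_gt0// DM.
  - exact: cvg_cst.
  - rewrite -[X in _ --> X](mulr0 (c * M)); apply: cvgM; first exact: cvg_cst.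
    by rewrite -[X in _ --> X](mulr0 0); exact: cvgM.
apply: (@squeeze_cvgr _ _ _ _ (fun ty => (1 + eta ty)^-1) (fun ty => (1 - eta ty)^-1)).
- near=> ty.
  have [t0 [r0 Dty]] : 0 < ty.1 /\ 0 < enorm ty.2 /\ D ty.
    by near: ty; apply: (@near_joint_infty _ _ _ 0) => t y t0 r0.
  have e1 : eta ty < 1 by near: ty; exact: cvgr_lt eta_cvg _ ltr01.
  move: t0 r0 Dty e1; rewrite [ty]surjective_pairing.
  move: ty.1 ty.2 => t y /= t0 r0 Dty e1; set r := enorm y in r0 *.
  have tr : delta * r ^+ 2 <= r ^+ 2 - 2 * l * t ^+ 2.
    have tM : t ^+ 2 <= (M * r) ^+ 2.
      rewrite lerXn2r ?nnegrE ?mulr_ge0 ?(ltW t0) ?(ltW M0) ?(ltW r0)//.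
      by rewrite -ler_pdivrMr// DM.
    by have := ler_wpM2l (ltW l0) tM; rewrite exprMn /delta; lra.
  have D0 : 0 < r ^+ 2 - 2 * l * t ^+ 2.
    by rewrite (lt_le_trans _ tr)// mulr_gt0// exprn_gt0.
  have h1 := le_int_killed_gauss_endpoint d l0 r0 t0 delta0 tr.
  have h2 := ge_int_killed_gauss_endpoint l0 r0 t0 delta0 tr e1.
  have /andP[] := fine_resetting_density_bounds x (ltW l0) (introT andP (conj h1 h2)).
  rewrite -/(A t y) -/r.
  have e0 : 0 <= eta (t, y) by rewrite mulr_ge0 ?divr_ge0 ?sqr_ge0 ?(ltW c0) ?(ltW t0).
  set k := killed_gauss d l r t; have k0 : 0 < k by exact: killed_gauss_gt0.
  have kE : expR (- (l * t)) * gauss_density t y = k by [].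
  set E := expR (_ / _); have E0 : 0 < E by exact: expR_gt0.
  have TE : expR (- (l * t)) * gauss_density t (y - x) = k * E.
    rewrite -kE /gauss_density -[RHS]mulrA; congr (_ * _).
    rewrite -[RHS]mulrA; congr (_ * _).
    rewrite -expRD sqr_enormB -/r; congr expR; by field; rewrite gt_eqF.
  set J := 2 * l / _.
  have JE : l * (2 * t ^+ 2 / (r ^+ 2 - 2 * l * t ^+ 2)) = J.
    rewrite /J expr_div_n.
    have -> : r ^+ 2 / t ^+ 2 - 2 * l = (r ^+ 2 - 2 * l * t ^+ 2) / t ^+ 2.
      by field; rewrite gt_eqF.
    by field; rewrite !gt_eqF.
  have J0 : 0 < J by rewrite -JE mulr_gt0// divr_gt0// mulr_gt0// exprn_gt0.
  have q0 : 0 < k * (J + E) by rewrite mulr_gt0// addr_gt0.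
  have JkE v : l * (2 * t ^+ 2 / (r ^+ 2 - 2 * l * t ^+ 2) * k / v) = J * k / v.
    by rewrite -JE !mulrA.
  rewrite TE !JkE kE -/(eta (t, y)) => g1 g2.
  have p1 : 0 < 1 + eta (t, y) by rewrite ltr_wpDr.
  have p2 : 0 < 1 - eta (t, y) by rewrite subr_gt0.
  have kE0 : 0 < k * E by rewrite mulr_gt0.
  apply/andP; split.
    rewrite ler_pdivlMr//; apply: le_trans g1.
    have : (1 + eta (t, y))^-1 * (k * E) <= k * E.
      by rewrite ler_piMl ?(ltW kE0)// invf_le1// lerDl.
    by move: (1 + _)^-1 => w; lra.
  rewrite ler_pdivrMr//; apply: le_trans g2 _.
  have : k * E <= (1 - eta (t, y))^-1 * (k * E).
    by rewrite ler_peMl ?(ltW kE0)// invf_ge1// gerBl.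
  by move: (1 - _)^-1 => w; lra.
- rewrite -[X in _ --> X]invr1; apply: cvgV; first exact: oner_neq0.
  by rewrite -[X in _ --> X](addr0 1); apply: cvgD => //; exact: cvg_cst.
- rewrite -[X in _ --> X]invr1; apply: cvgV; first exact: oner_neq0.
  by rewrite -[X in _ --> X](subr0 1); apply: cvgB => //; exact: cvg_cst.
Unshelve. all: by end_near. Qed.

End fixed_domain.

End resetting_limits.
(** * Existence of the density *)

Section probability_ae_eq.
Context {R : realType} {dO : measure_display} {Omega : measurableType dO}.
Variable P : probability Omega R.

Lemma probability_ae_le (A C : set Omega) : measurable A -> measurable C ->
  {ae P, forall w, A w -> C w} -> (P A <= P C)%E.
Proof.
move=> mA mC [Z [mZ PZ NZ]].
rewrite -[leRHS]adde0 -PZ; apply: le_trans (measureU2 _ _ _) => //.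
apply: le_measure; rewrite ?inE//; first exact: measurableU.
move=> w Aw; have [CwT|CwF] := pselect (C w); first by left.
by right; apply: NZ => /= hAC; exact: (CwF (hAC Aw)).
Qed.

(** [Y 0 = x] and [N 0 = 0] hold only almost surely; this carries such identities over to
    probabilities. *)
Lemma probability_ae_eq (A C : set Omega) : measurable A -> measurable C ->
  {ae P, forall w, A w <-> C w} -> P A = P C.
Proof.
move=> mA mC hAC; apply/eqP; rewrite eq_le !probability_ae_le//;
  by apply: filterS hAC => w [].
Qed.

End probability_ae_eq.

Section image_measure.
Context {d1 d2} {T1 : measurableType d1} {T2 : measurableType d2} {R : realType}.
Variables (m : {measure set T1 -> \bar R}) (f : T1 -> T2).
Hypothesis mf : measurable_fun [set: T1] f.

Definition image_measure : {measure set T2 -> \bar R} :=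
  measure_function_pushforward__canonical__measure_function_Measure m mf.

Lemma image_measureE A : image_measure A = m (f @^-1` A).
Proof. by []. Qed.

End image_measure.

(** * Translation invariance of Lebesgue measure *)

Section lebesgue_rV_translation.
Context {R : realType}.

(** Uniqueness of Lebesgue measure reduces the claim to half-open intervals. *)
Lemma lebesgue_measure_translation (c : R) (A : set R) :
  measurable (A : set (measurableTypeR R)) ->
  lebesgue_measure ((fun u => u + c) @^-1` A) = lebesgue_measure A.
Proof.
move=> mA; apply/esym.
have mD : measurable_fun setT ((fun u => u + c) : measurableTypeR R -> measurableTypeR R).
  by apply: (@measurable_funD _ _ _ setT id (cst c)).
apply: (@lebesgue_measure_unique R (image_measure lebesgue_measure mD)) => [_ [[a b]] _ <-|//].
rewrite image_measureE /=.
have -> : (fun u => u + c) @^-1` `]a, b]%classic = `](a - c), (b - c)]%classic.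
  by apply/seteqP; split=> u /=; rewrite !in_itv /= ltrBlDr lerBrDr.
rewrite !lebesgue_measure_itv /= !lte_fin ltrD2r; case: ifP => // _.
by rewrite -!EFinB; congr EFin; ring.
Qed.

Lemma measurable_rV_translation d (c : 'rV[R]_d) :
  measurable_fun setT (fun v : 'rV[R]_d => v + c).
Proof.
apply: measurable_fun_rV => i; under eq_fun do rewrite mxE.
by apply: measurable_funD => //; exact: measurable_coord_rV.
Qed.

(** Induction on the dimension: the translated product measure agrees with the product measure on
    rectangles, which determine it. *)
Lemma lebesgue_rV_translation d (c : 'rV[R]_d) (A : set 'rV[R]_d) :
  measurable A -> lebesgue_rV d ((fun v => v + c) @^-1` A) = lebesgue_rV d A.
Proof.
elim: d c A => [|d IH] c A mA.
  rewrite (_ : _ @^-1` A = A)//; apply/seteqP; split=> v /=;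
    by rewrite [c]thinmx0 addr0.
rewrite /= /lebesgue_rV_step /pushforward.
pose c' : 'rV[R]_d := \row_i c ord0 (lift ord0 i).
pose f (u : measurableTypeR R * 'rV[R]_d) : measurableTypeR R * 'rV[R]_d :=
  (u.1 + c ord0 ord0, u.2 + c').
have mf : measurable_fun setT f.
  apply: measurable_fun_pair; first by apply: measurable_funD.
  exact: measurableT_comp (measurable_rV_translation c') measurable_snd.
have consE u : cons_rV u + c = cons_rV (f u).
  apply/rowP => i; rewrite mxE; case: (unliftP ord0 i) => [j|] ->.
    by rewrite !cons_rVS /= !mxE.
  by rewrite !cons_rV0.
have -> : @cons_rV R d @^-1` ((fun v => v + c) @^-1` A) = f @^-1` (@cons_rV R d @^-1` A).
  by apply/funext => u; rewrite /preimage /= consE.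
have mcA : measurable (@cons_rV R d @^-1` A).
  by rewrite -[X in measurable X]setTI; exact: measurable_cons_rV.
rewrite [RHS](@product_measure_unique _ _ _ _ _ _ _
  (image_measure (lebesgue_measure \x lebesgue_rV d)%E mf))//.
move=> B C mB mC; rewrite image_measureE.
rewrite (_ : f @^-1` _ =
  ((fun u => u + c ord0 ord0) @^-1` B) `*` ((fun v => v + c') @^-1` C))//.
have mB' : measurable ((fun u => u + c ord0 ord0) @^-1` B : set (measurableTypeR R)).
  by rewrite -[X in measurable X]setTI; apply: (@measurable_funD _ _ _ setT id (cst _)).
have mC' : measurable ((fun v => v + c') @^-1` C).
  by rewrite -[X in measurable X]setTI; exact: measurable_rV_translation.
apply: (etrans (product_measure1E _ _ mB' mC')).
by congr (_ * _)%E; [exact: lebesgue_measure_translation|exact: IH].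
Qed.

Lemma ge0_integral_rV_translation d (c : 'rV[R]_d)
    (f : 'rV[R]_d -> \bar R) (A : set 'rV[R]_d) :
  measurable A -> measurable_fun A f -> (forall v, A v -> 0 <= f v)%E ->
  (\int[lebesgue_rV d]_(v in (fun v => v + c)%R @^-1` A) f (v + c)%R =
   \int[lebesgue_rV d]_(v in A) f v)%E.
Proof.
move=> mA mf f0.
rewrite [RHS](eq_measure_integral
  (image_measure (lebesgue_rV d) (measurable_rV_translation c))); last first.
  by move=> B mB _; apply/esym; exact: lebesgue_rV_translation.
rewrite ge0_integral_pushforward//; first exact: measurable_rV_translation.
by move=> v /[!inE]; exact: f0.
Qed.

End lebesgue_rV_translation.

(** * Arrival times and the age since the last reset *)

Section arrivals.
Context {R : realType} {dO : measure_display} {Omega : measurableType dO}.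
Variables (N : R -> Omega -> nat).
Hypotheses (Nnd : forall w s t, 0 <= s <= t -> (N s w <= N t w)%N)
  (Nrc : forall w t, 0 <= t -> \forall s \near t^'+, N s w = N t w).
Implicit Types (w : Omega) (s t a : R) (n : nat).

(** If [T_n <= s], the count reaches [n] before any [u > s], and right continuity provides such a
    [u] with [N_u = N_s]. *)
Lemma arrival_le n w s : 0 <= s ->
  (arrival N n w <= s%:E)%E = (n <= N s w)%N.
Proof.
move=> s0; apply/idP/idP => [h|h]; last first.
  by apply: ereal_inf_lbound; exists s.
have [u [su uE]] : exists u, s < u /\ N u w = N s w.
  near s^'+ => u; exists u; split; near: u; first exact: nbhs_right_gt.
  exact: Nrc.
have : (arrival N n w < u%:E)%E by rewrite (le_lt_trans h)// lte_fin.
move=> /ereal_inf_lt[_ [v [v0 nv] <-]]; rewrite lte_fin => vu.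
by rewrite -uE (leq_trans nv)// Nnd// v0 ltW.
Unshelve. all: by end_near. Qed.

Lemma arrival_ge0 n w : (0 <= arrival N n w)%E.
Proof. by apply: le_ereal_inf_tmp => _ [v [v0 _] <-]; rewrite lee_fin. Qed.

(** When [N_t = 0], the infimum defining [arrival N 0] is 0, so the age is [t]. *)
Definition reset_age t w : R := t - fine (arrival N (N t w) w).

Let last_arrivalE t w : 0 <= t ->
  arrival N (N t w) w = (t - reset_age t w)%:E /\ 0 <= t - reset_age t w.
Proof.
move=> t0; have at_ : (arrival N (N t w) w <= t%:E)%E by rewrite arrival_le.
have a0 := arrival_ge0 (N t w) w.
have fa : arrival N (N t w) w \is a fin_num.
  by rewrite ge0_fin_numE// (le_lt_trans at_)// ltry.
by rewrite subKr fineK// fine_ge0.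
Qed.

(** The age is at least [a] when [T_n <= t - a] for [n = N_t]; [arrival_le] turns this into a
    comparison of counts, that is, no arrival in []t - a, t]]. *)
Lemma le_reset_age t a w : 0 <= t -> a <= t ->
  (a <= reset_age t w) = (N t w <= N (t - a) w)%N.
Proof.
move=> t0 at_; have [aE _] := last_arrivalE w t0.
by rewrite -arrival_le ?subr_ge0// aE lee_fin lerD2l lerN2.
Qed.

Lemma reset_age_ge0 t w : 0 <= t -> 0 <= reset_age t w.
Proof. by move=> t0; rewrite le_reset_age// subr0. Qed.

Lemma reset_age_le t w : 0 <= t -> reset_age t w <= t.
Proof. by move=> t0; have [_] := last_arrivalE w t0; rewrite subr_ge0. Qed.

(** The index [n = N_t] is the one with [T_n <= t < T_(n+1)]. *)
Lemma total_resettingE d (Y X : R -> Omega -> 'rV[R]_d) t w :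
  total_resetting Y N X -> 0 <= t ->
  X t w = if N t w == 0%N then Y t w else Y t w - Y (t - reset_age t w) w.
Proof.
move=> HX t0; have [X0 Xn] := HX t w t0.
have lt_next : (t%:E < arrival N (N t w).+1 w)%E.
  by rewrite ltNge arrival_le// ltnn.
have [N0|N0] := eqVneq (N t w) 0%N; first by apply: X0; rewrite -N0.
rewrite (Xn (N t w)) ?lt0n// ?arrival_le//.
by have [-> _] := last_arrivalE w t0.
Qed.

End arrivals.

Section countable_index.
Context {d d'} {T : measurableType d} {T' : measurableType d'}.

Lemma measurable_fun_countable_index (g : T -> nat) (h : nat -> T -> T') :
  measurable_fun setT g -> (forall k, measurable_fun setT (h k)) ->
  measurable_fun setT (fun x => h (g x) x).
Proof.
move=> mg mh _ A mA; rewrite setTI.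
rewrite (_ : _ @^-1` A = \bigcup_k (g @^-1` [set k] `&` h k @^-1` A)).
  apply: bigcup_measurable => k _; apply: measurableI.
    by rewrite -[X in measurable X]setTI; exact: mg.
  by rewrite -[X in measurable X]setTI; exact: mh.
by apply/seteqP; split=> [x Ax|x [k _ [/= <-]]]//; exists (g x).
Qed.

End countable_index.

Section measurable_reset_age.
Context {R : realType} {dO : measure_display} {Omega : measurableType dO}.
Variables (N : R -> Omega -> nat).
Hypotheses (Nnd : forall w s t, 0 <= s <= t -> (N s w <= N t w)%N)
  (Nrc : forall w t, 0 <= t -> \forall s \near t^'+, N s w = N t w)
  (mN : forall t, 0 <= t -> measurable_fun setT (N t)).

Lemma measurable_counter_stalled (s t : R) : 0 <= s -> 0 <= t ->
  measurable [set w | (N t w <= N s w)%N].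
Proof.
move=> s0 t0.
rewrite (_ : [set _ | _] =
  \bigcup_k (N t @^-1` [set k] `&` N s @^-1` [set n | (k <= n)%N])).
  apply: bigcup_measurable => k _; apply: measurableI.
    by rewrite -[X in measurable X]setTI; exact: mN.
  by rewrite -[X in measurable X]setTI; exact: mN.
apply/seteqP; split=> [w /= h|w [k _ [/= -> ]]]//; by exists (N t w).
Qed.

Lemma measurable_reset_age (t : R) : 0 <= t ->
  measurable_fun setT (reset_age N t : Omega -> measurableTypeR R).
Proof.
move=> t0 mD; apply: (measurability _ (RGenCInfty.measurableE R)) => //.
move=> _ [_ [a ->] <-]; rewrite setTI.
have [at_|ta] := leP a t.
  rewrite (_ : _ @^-1` _ = [set w | (N t w <= N (t - a) w)%N]).
    by apply: measurable_counter_stalled => //; rewrite subr_ge0.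
  by apply/seteqP; split=> w /=; rewrite in_itv /= andbT le_reset_age.
rewrite (_ : _ @^-1` _ = set0)//; apply/seteqP; split=> w //=.
by rewrite in_itv /= andbT leNgt (le_lt_trans (reset_age_le _ _ _ t0) ta).
Qed.

End measurable_reset_age.

(** * The law of the age *)

Section age_law.
Context {R : realType}.
Local Notation mu := (@lebesgue_measure R).
Variables (l t : R).

(* The absolute value makes [age_law] a measure for every real [l]. *)
Definition age_pdf : R -> R := (fun u => `|l| * expR (- (l * u))) \_ `[0, t].

Lemma age_pdf_ge0 u : 0 <= age_pdf u.
Proof. by apply: restrict_ge0 => {}u _; rewrite mulr_ge0 ?expR_ge0. Qed.

Lemma measurable_age_pdf : measurable_fun setT age_pdf.
Proof.
apply/(measurable_restrictT _ (measurable_itv `[0, t])).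
apply: measurable_funTS; apply: measurable_funM => //; apply: measurableT_comp => //.
by apply: measurableT_comp => //; exact: measurable_funM.
Qed.

(** The law of the age on the event that a reset has occurred; for [l, t > 0] its total mass is
    [1 - e^(- l t)]. *)
Definition age_law (C : set (measurableTypeR R)) : \bar R :=
  (\int[mu]_(u in C) (age_pdf u)%:E)%E.

Let age_law0 : age_law set0 = 0%E. Proof. exact: integral_set0. Qed.

Let age_law_ge0 C : (0 <= age_law C)%E.
Proof. by apply: integral_ge0 => u _; rewrite lee_fin age_pdf_ge0. Qed.

Let age_law_sigma_additive : semi_sigma_additive age_law.
Proof.
move=> F mF tF mUF; rewrite /age_law ge0_integral_bigcup//.
- by apply: is_cvg_ereal_nneg_natsum_cond => n _ _; exact: age_law_ge0.
- by apply/measurable_EFinP; apply: measurable_funTS; exact: measurable_age_pdf.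
- by move=> u _; rewrite lee_fin age_pdf_ge0.
Qed.

HB.instance Definition _ := isMeasure.Build _ _ _ age_law
  age_law0 age_law_ge0 age_law_sigma_additive.

Let is_derive_exp (u : R) :
  is_derive u (1 : R) (fun u => expR (- (l * u))) (expR (- (l * u)) * - l).
Proof.
have h : is_derive u (1 : R) (fun u => - (l * u)) (- l).
  by apply: is_derive_eq; rewrite /GRing.scale /=; ring.
exact: is_derive1_comp (is_derive_expR _) h.
Qed.

Let continuous_exp : continuous (fun u : R => expR (- (l * u))).
Proof.
move=> u; apply: differentiable_continuous; apply/derivable1_diffP.
by have [] := is_derive_exp u.
Qed.

Let continuous_kernel : continuous (fun u : R => `|l| * expR (- (l * u))).
Proof. by move=> u; apply: cvgM; [exact: cvg_cst|exact: continuous_exp]. Qed.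

Let age_lawE C : age_law C =
  (\int[mu]_(u in C `&` `[0%R, t]) (`|l| * expR (- (l * u)))%:E)%E.
Proof.
rewrite [RHS]integral_mkcondr; apply: eq_integral => u _.
by rewrite /age_pdf !patchE; case: ifP.
Qed.

Let age_law_fin : fin_num_fun age_law.
Proof.
apply: lty_fin_num_fun; change (age_law setT < +oo)%E; rewrite age_lawE setTI.
suff : mu.-integrable `[0, t] (EFin \o (fun u => `|l| * expR (- (l * u)))).
  by move=> /integrable_fin_num => /(_ (measurable_itv _)) /fineK <-; exact: ltry.
apply: continuous_compact_integrable; first exact: segment_compact.
exact: continuous_subspaceT.
Qed.

HB.instance Definition _ := Measure_isFinite.Build _ _ _ age_law age_law_fin.

Hypotheses (l0 : 0 < l) (t0 : 0 < t).

(** [min] and [max] clip [a] to [[0, t]], so that one formula covers every ray. *)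
Lemma age_law_ray (a : R) :
  age_law `[a, +oo[ = (expR (- (l * Num.min t (Num.max a 0))) - expR (- (l * t)))%:E.
Proof.
rewrite age_lawE; set b := Num.max a 0.
have -> : `[a, +oo[%classic `&` `[0, t]%classic = `[b, t]%classic :> set R.
  apply/seteqP; split=> u /=; rewrite !in_itv /= andbT ge_max.
    by move=> [-> /andP[-> ->]].
  by move=> /andP[/andP[-> ->] ->].
have b0 : 0 <= b by rewrite le_max lexx orbT.
have [bt|tb] := ltP b t; last first.
  rewrite subrr; move: tb; rewrite le_eqVlt => /predU1P[<-|tb].
    by rewrite set_itv1 integral_set1.
  by rewrite set_itv_ge ?integral_set0// bnd_simp -ltNge.
have dF (u : R) : is_derive u (1 : R) (fun u => - expR (- (l * u)))
    (`|l| * expR (- (l * u))).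
  by have := is_derive_exp u => h; apply: is_derive_eq; rewrite gtr0_norm//; ring.
have cF (u : R) : {for u, continuous (fun u => - expR (- (l * u)))}.
  by apply: cvgN; exact: continuous_exp.
rewrite (@continuous_FTC2 _ _ (fun u => - expR (- (l * u))))//.
- by rewrite -EFinB; congr EFin; ring.
- exact: continuous_subspaceT.
- split.
  + by move=> u _; have [] := dF u.
  + by apply: cvg_at_right_filter; exact: cF.
  + by apply: cvg_at_left_filter; exact: cF.
- by move=> u _; rewrite derive1E; have [_ ->] := dF u.
Qed.

End age_law.

Section reset_age_law.
Context {R : realType} {dO : measure_display} {Omega : measurableType dO}.
Variables (P : probability Omega R) (l : R) (N : R -> Omega -> nat).
Hypotheses (l0 : 0 < l) (HN : poisson_process P l N).

(** The comparison of counts says that the truncated increment is 0, an event whose Poisson weight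
    is the exponential. *)
Lemma poisson_stalled (s t : R) : 0 <= s < t ->
  P [set w | (N t w <= N s w)%N] = (expR (- (l * (t - s))))%:E.
Proof.
move=> st; have := pp_poisson HN 0 st; rewrite /poisson_pmf.
have /andP[_ st'] := st; rewrite mulr_gt0 ?subr_gt0// expr0 fact0 invr1 !mul1r => <-.
congr (P _); apply/seteqP; split=> w /=; first by rewrite -subn_eq0 => /eqP.
by move=> /eqP; rewrite subn_eq0.
Qed.

Let mN t : 0 <= t -> measurable_fun setT (N t). Proof. exact: (pp_measurable HN). Qed.

Let mNk t (A : set nat) : 0 <= t -> measurable (N t @^-1` A).
Proof. by move=> t0; rewrite -[X in measurable X]setTI; exact: mN. Qed.

Lemma poisson_unstarted (t : R) : 0 < t ->
  P [set w | N t w = 0%N] = (expR (- (l * t)))%:E.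
Proof.
move=> t0; have := @poisson_stalled 0 t.
rewrite lexx t0 subr0 => <- //; apply: probability_ae_eq.
- exact: (mNk [set 0%N] (ltW t0)).
- exact: measurable_counter_stalled mN _ _ (lexx _) (ltW t0).
- by apply: filterS (pp_start HN) => w /= ->; rewrite leqn0; split=> [->|/eqP].
Qed.

(** Closed rays form a generating pi-system. On [[a, +oo[] with [0 <= a <= t], the event is
    [N_t <= N_(t - a)] minus [N_t = 0], of probability [e^(- l a) - e^(- l t)]. *)
Lemma reset_age_law (t : R) (C : set (measurableTypeR R)) : 0 < t -> measurable C ->
  P ([set w | (0 < N t w)%N] `&` reset_age N t @^-1` C) = age_law l t C.
Proof.
move=> t0 mC; have t0' := ltW t0.
have Nnd w s u : 0 <= s <= u -> (N s w <= N u w)%N.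
  by move=> ?; exact: (pp_nondecreasing HN).
have Nrc w u : 0 <= u -> \forall s \near u^'+, N s w = N u w.
  by move=> ?; exact: (pp_right_continuous HN).
have mU := measurable_reset_age Nnd Nrc mN t0'.
have mB : measurable [set w | (0 < N t w)%N] by exact: (mNk [set n | (0 < n)%N] t0').
rewrite setIC.
pose m1 : {measure set (measurableTypeR R) -> \bar R} := image_measure (mrestr P mB) mU.
pose m2 : {measure set (measurableTypeR R) -> \bar R} := age_law l t.
change (m1 C = m2 C).
apply: (@measure_unique _ R (measurableTypeR R) (@RGenCInfty.G R)
  (fun n => `[(- n%:R)%R, +oo[%classic) _ _ _ _ m1 m2 _ _ C mC).
- exact: RGenCInfty.measurableE.
- move=> _ _ [a ->] [b ->]; exists (Num.max a b).
  by apply/seteqP; split=> u /=; rewrite !in_itv /= !andbT ge_max => /andP.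
- by move=> n; exists (- n%:R).
- apply/seteqP; split=> // u _; exists (Num.truncn (- u)).+1 => //=.
  by rewrite in_itv /= andbT lerNl ltW// truncnS_gt.
- move=> _ [a ->]; rewrite [RHS]age_law_ray// /m1 image_measureE /= /mrestr.
  have [at_|ta] := leP a t; last first.
    rewrite (_ : _ `&` _ = set0); last first.
      apply/seteqP; split=> // w [/=]; rewrite in_itv /= andbT => aU _.
      by have := le_lt_trans (reset_age_le Nnd Nrc w t0') ta; rewrite ltNge aU.
    by rewrite measure0 min_l ?subrr// le_max (ltW ta).
  have -> : reset_age N t @^-1` `[a, +oo[%classic `&` [set w | (0 < N t w)%N] =
      [set w | (N t w <= N (t - a) w)%N] `\` [set w | N t w = 0%N].
    apply/seteqP; split=> w /=; rewrite in_itv /= andbT le_reset_age//.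
      by move=> [-> ]; rewrite lt0n => /eqP.
    by move=> [-> /eqP]; rewrite -lt0n.
  have ta0 : 0 <= t - a by rewrite subr_ge0.
  rewrite measureD//; last 3 first.
  - exact: measurable_counter_stalled.
  - exact: (mNk [set 0%N]).
  - by rewrite (le_lt_trans (probability_le1 _ _)) ?ltry//; exact: measurable_counter_stalled.
  rewrite (setIidr _); last by move=> w /= ->.
  rewrite EFinB; congr (_ - _)%E; last exact: poisson_unstarted.
  have [a0|a0] := leP a 0.
    rewrite min_r ?(ltW t0)// mulr0 oppr0 expR0.
    rewrite (_ : [set w | _] = setT); first exact: probability_setT.
    by apply/seteqP; split=> // w _ /=; apply: Nnd; rewrite t0' lerBrDr gerDl.
  apply: (etrans (poisson_stalled _)); first by rewrite ta0 gtrBl.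
  by rewrite subKr min_r.
- by move=> n; rewrite /m1 image_measureE /= /mrestr (le_lt_trans (probability_le1 _ _)) ?ltry//;
    apply: measurableI => //; rewrite -[X in measurable X]setTI; exact: (mU measurableT).
Qed.

End reset_age_law.

(** [Omega] with the sigma-algebra of [Z] alone: measurability from this space expresses dependence
    on the process only. *)
Notation process_space Z :=
  (g_sigma_algebraType (\bigcup_(t in [set t | 0 <= t])
     preimage_set_system setT (Z t) measurable)).

Section process_space.
Context {R : realType} {dO dT} {Omega : measurableType dO} {T : measurableType dT}.
Variable Z : R -> Omega -> T.

Lemma measurable_process (t : R) : 0 <= t ->
  measurable_fun setT (Z t : process_space Z -> T).
Proof.
move=> t0 _ A mA; rewrite setTI; apply: sub_sigma_algebra.
by exists t => //; exists A => //; rewrite setTI.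
Qed.

Lemma measurable_process_space_id : (forall t, 0 <= t -> measurable_fun setT (Z t)) ->
  measurable_fun setT (id : Omega -> process_space Z).
Proof.
move=> mZ _ A mA; rewrite setTI.
suff H : @measurable _ (process_space Z) `<=` (@measurable _ Omega) by exact: H.
apply: smallest_sub; first exact: sigma_algebra_measurable.
by move=> _ [t t0 [B mB <-]]; exact: mZ.
Qed.

End process_space.

(** * Joint measurability of continuous paths *)

Section measurable_path.
Context {R : realType} {dT} {T : measurableType dT} {d : nat}.
Variable Y : R -> T -> 'rV[R]_d.
Hypotheses (mY : forall t, 0 <= t -> measurable_fun setT (Y t))
  (cY : forall w, {within `[0, +oo[, continuous (fun t => Y t w)}).

Lemma measurable_truncn (f : T * measurableTypeR R -> R) : measurable_fun setT f ->
  (forall u, 0 <= f u) -> measurable_fun setT (fun u => Num.truncn (f u)).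
Proof.
move=> mf f0 _ A _; rewrite setTI.
rewrite (_ : _ @^-1` A = \bigcup_(k in A) f @^-1` `[k%:R, k.+1%:R[).
  apply: bigcup_measurable => k _; rewrite -[X in measurable X]setTI.
  by apply: mf => //; exact: measurable_itv.
apply/seteqP; split=> [u /= Au|u [k Ak]] /=.
  by exists (Num.truncn (f u)) => //=; rewrite in_itv /= truncn_itv.
by rewrite in_itv /= => /truncn_def ->.
Qed.

Let grid (n : nat) (s : R) : R := (Num.truncn (s * n.+1%:R))%:R / n.+1%:R.

Let grid_cvg (s : R) : 0 <= s -> grid n s @[n --> \oo] --> s.
Proof.
move=> s0; apply: (@squeeze_cvgr _ _ _ _ (fun n => s - n.+1%:R^-1) (fun=> s)).
- apply: nearW => n; have /andP[h1 h2] := truncn_itv (mulr_ge0 s0 (ler0n R n.+1)).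
  rewrite /grid ler_pdivrMr// h1 andbT ler_pdivlMr// mulrBl mulVf ?pnatr_eq0//.
  by rewrite lerBlDr natr1 ltW.
- by rewrite -[X in _ --> X]subr0; apply: cvgB; [exact: cvg_cst|exact: cvg_harmonic].
- exact: cvg_cst.
Qed.

Let grid_ge0 (n : nat) (s : R) : 0 <= grid n s.
Proof. by rewrite divr_ge0. Qed.

(** Step processes along the grids of mesh [1 / (n + 1)] use countably many times, hence are jointly
    measurable, and they converge pointwise by continuity. [Num.max 0] extends the path to negative
    times. *)
Lemma measurable_path :
  measurable_fun setT (fun wu : T * measurableTypeR R => Y (Num.max 0 wu.2) wu.1).
Proof.
apply: measurable_fun_rV => i.
have mmax : measurable_fun setT (fun wu : T * measurableTypeR R => Num.max 0 wu.2).
  exact: measurable_maxr.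
apply: (@measurable_fun_cvg _ _ _ _
  (fun n (wu : T * measurableTypeR R) => Y (grid n (Num.max 0 wu.2)) wu.1 ord0 i)).
  move=> n; pose g (wu : T * measurableTypeR R) := Num.truncn (Num.max 0 wu.2 * n.+1%:R).
  have mg : measurable_fun setT g.
    apply: measurable_truncn; first exact: measurable_funM.
    by move=> u; rewrite mulr_ge0// le_max lexx.
  pose h (k : nat) (wu : T * measurableTypeR R) : R := Y (k%:R / n.+1%:R) wu.1 ord0 i.
  apply: (measurable_fun_countable_index (h := h) mg) => k.
  apply: (measurableT_comp (measurable_coord_rV i)).
  by apply: measurableT_comp; [apply: mY; rewrite divr_ge0|exact: measurable_fst].
move=> [w u] _ /=; have : 0 <= (Num.max 0 u : R) by rewrite le_max lexx.
move: (Num.max 0 u : R) => s s0.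
have : (fun t => Y t w) @ within `[0, +oo[%classic (nbhs s) --> Y s w.
  rewrite (@nbhs_subspace_in R (`[0%R, +oo[%classic : set R) s); first exact: (@cY w s).
  by rewrite /= in_itv /= s0.
move=> cs; have {}cs : Y (grid n s) w @[n --> \oo] --> Y s w.
  apply: cvg_comp cs => A [e /= e0 eA].
  have := grid_cvg s0 => /(_ (ball s e)) /(_ (nbhsx_ballx _ _ _)).
  case=> // m _ hm; exists m => // n /hm /= nb; apply: eA => //=.
  by rewrite in_itv /= grid_ge0.
exact: (cvg_comp _ _ cs (@coord_continuous _ _ _ _ _ (Y s w))).
Qed.

End measurable_path.

Section gauss_measurability.
Context {R : realType} {d : nat}.

Lemma measurable_enorm : measurable_fun setT (@enorm R d).
Proof.
rewrite (_ : @enorm R d = fun y => (dotp y y) `^ 2^-1); last first.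
  by apply/funext => y; rewrite powR12_sqrt// dotp_ge0.
apply: (measurableT_comp (measurable_powR _)); rewrite /dotp.
apply: measurable_sum => i; apply: measurable_funM; exact: measurable_coord_rV.
Qed.

Lemma measurable_gauss_density :
  measurable_fun setT (fun uy : measurableTypeR R * 'rV[R]_d => gauss_density uy.1 uy.2).
Proof.
have m1 : measurable_fun setT (fun uy : measurableTypeR R * 'rV[R]_d => uy.1 : R).
  exact: measurable_fst.
have mc (c : R) : measurable_fun setT
    (fun uy : measurableTypeR R * 'rV[R]_d => c * uy.1 : R).
  exact: measurable_funM.
apply: measurable_funM; first exact: (measurableT_comp (measurable_powR _) (mc _)).
apply: measurableT_comp => //; apply: measurableT_comp => //; apply: measurable_funM.
  apply: (measurableT_comp (exprn_measurable 2)).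
  exact: (measurableT_comp measurable_enorm measurable_snd).
exact: (measurableT_comp measurable_invr (mc _)).
Qed.

Lemma gauss_density_ge0 (u : R) (y : 'rV[R]_d) : 0 <= gauss_density u y.
Proof. by rewrite mulr_ge0 ?powR_ge0 ?expR_ge0. Qed.

End gauss_measurability.

(** * The law of the process with resetting at a fixed time *)

Section resetting_law.
Context {R : realType} {d : nat} {dO : measure_display} {Omega : measurableType dO}.
Local Notation mu := (@lebesgue_measure R).
Local Notation L := (@lebesgue_rV R d).
Variables (P : probability Omega R) (l : R) (x : 'rV[R]_d).
Variables (Y X : R -> Omega -> 'rV[R]_d) (N : R -> Omega -> nat) (t : R).
Hypotheses (l0 : 0 < l) (t0 : 0 < t).
Hypotheses (HY : brownian_motion P x Y) (HN : poisson_process P l N)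
  (HI : independent_processes P Y N) (HX : total_resetting Y N X).

Let t0' : 0 <= t. Proof. exact: ltW. Qed.

Let B : set Omega := [set w | (0 < N t w)%N].
Let U : Omega -> measurableTypeR R := reset_age N t.

Let Nnd w s u : 0 <= s <= u -> (N s w <= N u w)%N.
Proof. by move=> ?; exact: (pp_nondecreasing HN). Qed.
Let Nrc w u : 0 <= u -> \forall s \near u^'+, N s w = N u w.
Proof. by move=> ?; exact: (pp_right_continuous HN). Qed.

Let mB : measurable B.
Proof.
rewrite -[X in measurable X]setTI.
exact: (pp_measurable HN t0' measurableT (Y := [set n | (0 < n)%N])).
Qed.

Let mU : measurable_fun setT U.
Proof. exact: (measurable_reset_age (@Nnd) (@Nrc) (pp_measurable HN) t0'). Qed.

Let mYid : measurable_fun setT (id : Omega -> process_space Y).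
Proof. exact: measurable_process_space_id (bm_measurable HY). Qed.

(** [P] restricted to the sigma-algebra of [Y], as the image of [P] by the identity. *)
Let PY : probability (process_space Y) R :=
  distribution P (mfun_Sub (mem_set mYid)).

Let mpair : measurable_fun setT
  (fun w => (w, U w) : (process_space Y * measurableTypeR R)%type).
Proof. exact: measurable_fun_pair. Qed.

Let independent_clock (A C : set Omega) :
  process_sigma_algebra Y A -> process_sigma_algebra N C -> P (A `&` C) = (P A * P C)%E.
Proof. exact: HI. Qed.

(** Measurability of the age is applied with the sigma-algebra of [N] in place of that of [Omega],
    which makes the event eligible for the independence hypothesis. *)
Let clock_event (C : set (measurableTypeR R)) : measurable C ->
  process_sigma_algebra N (B `&` U @^-1` C).
Proof.
move=> mC; change (@measurable _ (process_space N) (B `&` U @^-1` C)).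
have mN u : 0 <= u -> measurable_fun setT (N u : process_space N -> nat).
  exact: measurable_process.
apply: measurableI.
  rewrite -[X in measurable X]setTI.
  exact: (mN t t0' measurableT [set n | (0 < n)%N]).
rewrite -[X in measurable X]setTI.
exact: (@measurable_reset_age R _ (process_space N) N (@Nnd) (@Nrc) mN t t0'
  measurableT C mC).
Qed.

(* [B] and [U] depend on [N] only: by independence, the law of [(Y, U)] on [B]
   is a product. *)
Let joint_law (E : set (process_space Y * measurableTypeR R)) : measurable E ->
  P (B `&` [set w | E (w, U w)]) = (PY \x age_law l t)%E E.
Proof.
move=> mE; rewrite setIC; apply/esym.
apply: (@product_measure_unique _ _ _ _ _ PY (age_law l t)
  (image_measure (mrestr P mB) mpair)) => // A C mA mC.
rewrite image_measureE /= /mrestr -(reset_age_law l0 HN t0 mC).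
rewrite (_ : _ `&` _ = A `&` (B `&` U @^-1` C)); last first.
  by rewrite setIA setIAC.
exact: (independent_clock mA (clock_event mC)).
Qed.

(** Tonelli exchanges path and age: the joint law becomes a mixture, over fixed ages [u], of laws of
    sections. *)
Let integrated_law (E : set (process_space Y * measurableTypeR R)) : measurable E ->
  ((PY \x age_law l t) E = \int[mu]_u ((age_pdf l t u)%:E * PY (ysection E u)))%E.
Proof.
move=> mE; rewrite /product_measure1.
pose f (wu : process_space Y * measurableTypeR R) : \bar R :=
  ((age_pdf l t wu.2)%:E * (\1_E wu)%:E)%E.
have f0 wu : (0 <= f wu)%E by rewrite mule_ge0// lee_fin// age_pdf_ge0.
have mf : measurable_fun setT f.
  apply: emeasurable_funM; apply/measurable_EFinP => //.
  exact: (measurableT_comp (measurable_age_pdf l t) measurable_snd).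
transitivity (\int[PY]_w \int[mu]_u f (w, u))%E.
  apply: eq_integral => w _ /=; rewrite /age_law integral_mkcond.
  apply: eq_integral => u _; rewrite /f /= patchE indicE mem_xsection.
  by case: ifPn => _; rewrite ?mule1 ?mule0.
rewrite (fubini_tonelli f)//; apply: eq_integral => u _.
rewrite /f /= ge0_integralZl_EFin//; last 2 first.
- apply/measurable_EFinP; apply: (measurableT_comp (measurable_indic mE)).
  exact: measurable_fun_pair.
- exact: age_pdf_ge0.
congr (_ * _)%E.
transitivity (\int[PY]_w (\1_(ysection E u) w)%:E)%E.
  by apply: eq_integral => w _; rewrite !indicE mem_ysection.
by rewrite integral_indic ?setIT//; exact: measurable_ysection.
Qed.

(** [Num.max 0] keeps the time nonnegative for every real age; by [max_age] it changes nothing at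
    the actual age. *)
Let V (wu : process_space Y * measurableTypeR R) : 'rV[R]_d :=
  Y t wu.1 - Y (Num.max 0 (t - wu.2)) wu.1.

Let mV : measurable_fun setT V.
Proof.
have mYt u : 0 <= u -> measurable_fun setT (Y u : process_space Y -> 'rV[R]_d).
  exact: measurable_process.
have mp : measurable_fun setT (fun wu : process_space Y * measurableTypeR R =>
    (wu.1, t - wu.2) : (process_space Y * measurableTypeR R)%type).
  apply: measurable_fun_pair; first exact: measurable_fst.
  by apply: measurable_funB => //; exact: measurable_snd.
have mpath := measurableT_comp (measurable_path mYt (bm_continuous HY)) mp.
have m1 := measurableT_comp (mYt t t0')
  (@measurable_fst _ _ (process_space Y) (measurableTypeR R)).
apply: measurable_fun_rV => i.
rewrite (_ : (fun _ => _) = (fun wu =>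
    Y t wu.1 ord0 i - Y (Num.max 0 (t - wu.2)) wu.1 ord0 i)); last first.
  by apply/funext => wu; rewrite /V !mxE.
apply: measurable_funB.
  exact: (measurableT_comp (measurable_coord_rV i) m1).
exact: (measurableT_comp (measurable_coord_rV i) mpath).
Qed.

Let mVA (A : set 'rV[R]_d) : measurable A -> measurable (V @^-1` A).
Proof. by move=> mA; rewrite -[X in measurable X]setTI; exact: mV. Qed.

Let max_age w : Num.max 0 (t - U w) = t - U w.
Proof. by rewrite max_r// subr_ge0 (reset_age_le (@Nnd) (@Nrc)). Qed.

(** At a fixed age [u], the section is an event on the increment over [[t - u, t]]. For [u = 0] the
    increment is identically 0 and [bm_gaussian] does not apply. *)
Let increment_law (A : set 'rV[R]_d) (u : R) : measurable A -> 0 < u <= t ->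
  PY (ysection (V @^-1` A) u) = (\int[L]_(y in A) (gauss_density u y)%:E)%E.
Proof.
move=> mA /andP[u0 ut]; have tu : 0 <= t - u < t by rewrite subr_ge0 ut gtrBl.
have [_ _ _ /(_ A mA)] := bm_gaussian HY tu; rewrite subKr => <-.
congr (P _); apply/seteqP; split=> w; rewrite /ysection /= inE /V /=;
  by rewrite max_r// subr_ge0.
Qed.

Let kernel (uy : measurableTypeR R * 'rV[R]_d) : \bar R :=
  (l * expR (- (l * uy.1)) * gauss_density uy.1 uy.2)%:E.

Let kernel_ge0 uy : (0 <= kernel uy)%E.
Proof.
by rewrite lee_fin mulr_ge0 ?gauss_density_ge0// mulr_ge0 ?expR_ge0// ltW.
Qed.

Let mkernel : measurable_fun setT kernel.
Proof.
apply/measurable_EFinP; apply: measurable_funM; last exact: measurable_gauss_density.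
apply: measurable_funM => //; apply: measurableT_comp => //; apply: measurableT_comp => //.
by apply: measurable_funM => //; exact: measurable_fst.
Qed.

Let mkernel1 (y : 'rV[R]_d) : measurable_fun setT (fun u => kernel (u, y)).
Proof. exact: (measurable_fun_pair1 y mkernel). Qed.

Let mkernel2 (u : measurableTypeR R) : measurable_fun setT (fun y => kernel (u, y)).
Proof. exact: (measurable_fun_pair2 u mkernel). Qed.

Let reset_part (A : set 'rV[R]_d) : measurable A ->
  P (B `&` [set w | A (Y t w - Y (t - U w) w)]) =
  (\int[L]_(y in A) \int[mu]_(u in `[0%R, t]) kernel (u, y))%E.
Proof.
move=> mA; have mVA' := mVA mA.
rewrite (_ : [set w | _] = [set w | (V @^-1` A) (w, U w)]); last first.
  by apply/funext => w; rewrite /= /V /= max_age.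
rewrite joint_law// integrated_law//.
transitivity (\int[mu]_(u in `]0%R, t]) \int[L]_(y in A) kernel (u, y))%E.
  transitivity (\int[mu]_(u in `[0%R, t])
      ((l * expR (- (l * u)))%:E * PY (ysection (V @^-1` A) u)))%E.
    rewrite [RHS]integral_mkcond; apply: eq_integral => u _.
    rewrite /age_pdf !patchE; case: ifP => _; last by rewrite mul0e.
    by rewrite gtr0_norm.
  (* The null point [u = 0] is removed before the increment law is used. *)
  rewrite -integral_itv_obnd_cbnd; last first.
    apply: measurable_funTS; apply: emeasurable_funM; last exact: measurable_fun_ysection.
    apply/measurable_EFinP; apply: measurable_funM => //; apply: measurableT_comp => //.
    by apply: measurableT_comp => //; exact: measurable_funM.
  apply: eq_integral => u; rewrite inE /= in_itv /= => ut.
  rewrite increment_law// -ge0_integralZl_EFin//.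
  - by move=> y _; rewrite lee_fin gauss_density_ge0.
  - apply/measurable_EFinP; apply: measurable_funTS.
    exact: (measurable_fun_pair2 u measurable_gauss_density).
  - by rewrite mulr_ge0 ?expR_ge0// ltW.
(* Extension by 0 outside [D] puts both integrals over whole spaces, where Tonelli applies. *)
pose D := (`]0%R, t]%classic : set (measurableTypeR R)) `*` A.
have mD : measurable D by apply: measurableX => //; exact: measurable_itv.
pose f := kernel \_ D.
have mf : measurable_fun setT f.
  by apply/(measurable_restrictT _ mD); exact: measurable_funTS.
have f0 uy : (0 <= f uy)%E by rewrite /f patchE; case: ifP.
have fE u y : f (u, y) =
    if (u \in `]0%R, t]%classic) && (y \in A) then kernel (u, y) else 0%E.
  by rewrite /f patchE /D in_setX.
transitivity (\int[mu]_u \int[L]_y f (u, y))%E.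
  rewrite [LHS]integral_mkcond; apply: eq_integral => u _; rewrite patchE.
  case: ifP => uI.
    by rewrite integral_mkcond; apply: eq_integral => y _; rewrite fE uI patchE.
  by rewrite integral0_eq// => y _; rewrite fE uI.
rewrite (fubini_tonelli f mf f0) [RHS]integral_mkcond; apply: eq_integral => y _.
rewrite patchE; case: ifP => yA; last by rewrite integral0_eq// => u _; rewrite fE yA andbF.
transitivity (\int[mu]_(u in `]0%R, t]) kernel (u, y))%E; last first.
  by apply: integral_itv_obnd_cbnd; apply: measurable_funTS; exact: mkernel1.
by rewrite [RHS]integral_mkcond; apply: eq_integral => u _; rewrite fE yA andbT patchE.
Qed.

Let mgauss_shift : measurable_fun setT (fun y : 'rV[R]_d => gauss_density t (y - x) : R).
Proof.
exact: (measurableT_comp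
  (measurable_fun_pair2 (t : measurableTypeR R) measurable_gauss_density)
  (measurable_rV_translation (- x))).
Qed.

Let mY u (A : set 'rV[R]_d) : 0 <= u -> measurable A -> measurable (Y u @^-1` A).
Proof.
by move=> u0 mA; rewrite -[X in measurable X]setTI; exact: (bm_measurable HY u0).
Qed.

(** Independence splits off the probability of [N_t = 0]. As [Y_0 = x] almost surely, the law of
    [Y_t] is that of [Y_t - Y_0] translated by [x]. *)
Let free_part (A : set 'rV[R]_d) : measurable A ->
  P ([set w | N t w = 0%N] `&` Y t @^-1` A) =
  (\int[L]_(y in A) (expR (- (l * t)) * gauss_density t (y - x))%:E)%E.
Proof.
move=> mA; rewrite setIC independent_clock; last 2 first.
- change (@measurable _ (process_space Y) (Y t @^-1` A)).
  by rewrite -[X in measurable X]setTI; exact: (measurable_process t0').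
- change (@measurable _ (process_space N) (N t @^-1` [set 0%N])).
  by rewrite -[X in measurable X]setTI; exact: (measurable_process t0').
rewrite (poisson_unstarted l0 HN t0) muleC.
have tt : (0 : R) <= 0 < t by rewrite lexx t0.
have [mYt0 _ _ dY] := bm_gaussian HY tt; rewrite subr0 in dY.
pose A' : set 'rV[R]_d := (fun v => v + x) @^-1` A.
have mA' : measurable A'.
  by rewrite -[X in measurable X]setTI; exact: measurable_rV_translation.
have -> : P (Y t @^-1` A) = P ((fun w => Y t w - Y 0 w) @^-1` A').
  apply: probability_ae_eq; first exact: mY.
    by rewrite -[X in measurable X]setTI; exact: mYt0.
  by apply: filterS (bm_start HY) => w /= ->; rewrite /A' /= subrK.
rewrite (dY A' mA').
transitivity (\int[L]_(v in A') ((expR (- (l * t)))%:E * (gauss_density t v)%:E))%E.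
  apply/esym; apply: ge0_integralZl_EFin.
  - exact: mA'.
  - by move=> v _; rewrite lee_fin gauss_density_ge0.
  - apply/measurable_EFinP; apply: measurable_funTS.
    exact: (measurable_fun_pair2 (t : measurableTypeR R) measurable_gauss_density).
  - exact: expR_ge0.
rewrite -(ge0_integral_rV_translation x mA).
- by apply: eq_integral => v _; rewrite addrK EFinM.
- apply/measurable_EFinP; apply: measurable_funTS.
  by apply: measurable_funM; [exact: measurable_cst|exact: mgauss_shift].
- by move=> v _; rewrite lee_fin mulr_ge0 ?expR_ge0 ?gauss_density_ge0.
Qed.

Let preimageE (A : set 'rV[R]_d) : X t @^-1` A =
  ([set w | N t w = 0%N] `&` Y t @^-1` A) `|`
  (B `&` [set w | A (Y t w - Y (t - U w) w)]).
Proof.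
apply/seteqP; split=> w /=; rewrite (total_resettingE (@Nnd) (@Nrc) w HX t0').
  case: eqVneq => [N0 Aw|N0 Aw]; [by left|right]; split=> //.
  by rewrite /B /= lt0n.
move=> [[N0 Aw]|[N0 Aw]]; first by rewrite N0 eqxx.
by rewrite gtn_eqF.
Qed.

Let mfree (A : set 'rV[R]_d) : measurable A ->
  measurable ([set w | N t w = 0%N] `&` Y t @^-1` A).
Proof.
move=> mA; apply: measurableI; last exact: mY.
rewrite -[X in measurable X]setTI.
exact: (pp_measurable HN t0' measurableT (Y := [set 0%N])).
Qed.

Let mreset (A : set 'rV[R]_d) : measurable A ->
  measurable (B `&` [set w | A (Y t w - Y (t - U w) w)]).
Proof.
move=> mA; apply: measurableI => //.
rewrite (_ : [set w | _] = (fun w => (w, U w)) @^-1` (V @^-1` A)).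
  by rewrite -[X in measurable X]setTI; apply: mpair => //; exact: mVA.
by apply/funext => w; rewrite /preimage /= /V /= max_age.
Qed.

(** The event [X_t] in [A] splits according to whether a reset has occurred; [free_part] and
    [reset_part] give one summand of the density each. *)
Lemma resetting_has_density : has_density P (X t) (resetting_density l t x).
Proof.
(* As a function of [y], the integral term is the marginal of a nonnegative jointly measurable
   function. *)
have mint : measurable_fun setT
    (fun y : 'rV[R]_d => \int[mu]_(u in `[0%R, t]) kernel (u, y))%E.
  pose D := (`[0%R, t]%classic : set (measurableTypeR R)) `*` [set: 'rV[R]_d].
  have mD : measurable D by apply: measurableX => //; exact: measurable_itv.
  rewrite (_ : (fun _ => _) = fubini_G mu (kernel \_ D)); last first.
    apply/funext => y; rewrite /fubini_G [LHS]integral_mkcond; apply: eq_integral => u _.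
    by rewrite !patchE /D in_setX in_setT andbT.
  apply: measurable_fun_fubini_tonelli_G.
    by apply/(measurable_restrictT _ mD); exact: measurable_funTS.
  by move=> uy; rewrite patchE; case: ifP.
have mfirst : measurable_fun setT
    (fun y : 'rV[R]_d => (expR (- (l * t)) * gauss_density t (y - x))%:E).
  by apply/measurable_EFinP; exact: measurable_funM.
have int_ge0 y : (0 <= \int[mu]_(u in `[0%R, t]) kernel (u, y))%E.
  by apply: integral_ge0 => u _; exact: kernel_ge0.
have first_ge0 y : (0 <= (expR (- (l * t)) * gauss_density t (y - x))%:E)%E.
  by rewrite lee_fin mulr_ge0 ?expR_ge0 ?gauss_density_ge0.
split.
- move=> _ A mA; rewrite setTI preimageE; apply: measurableU; [exact: mfree|exact: mreset].
- exact: emeasurable_funD.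
- by move=> y; apply: adde_ge0; [exact: first_ge0|exact: int_ge0].
- move=> A mA; rewrite preimageE measureU//; last 3 first.
  + exact: mfree.
  + exact: mreset.
  + by apply/seteqP; split=> // w [[/= N0 _] [+ _]]; rewrite /B /= N0.
  apply: (etrans (congr2 +%E (free_part mA) (reset_part mA))).
  apply/esym; apply: ge0_integralD.
  + exact: mA.
  + by move=> y _; exact: first_ge0.
  + exact: measurable_funTS.
  + by move=> y _; exact: int_ge0.
  + exact: measurable_funTS.
Qed.

End resetting_law.

(** * Existence of the density and the three regimes together *)

Unset Implicit Arguments.

Theorem theorem1p3 (R : realType) (d : nat) (hd : (1 <= d)%N)
    (lambda : R) (hlambda : 0 < lambda) (x : 'rV[R]_d) :
  (forall (dO : measure_display) (Omega : measurableType dO)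
      (P : probability Omega R)
      (Y : R -> Omega -> 'rV[R]_d) (N : R -> Omega -> nat)
      (X : R -> Omega -> 'rV[R]_d),
    brownian_motion P x Y ->
    poisson_process P lambda N ->
    independent_processes P Y N ->
    total_resetting Y N X ->
    forall t : R, 0 < t -> has_density P (X t) (resetting_density lambda t x))
  /\
  (forall M : R, (Num.sqrt (2 * lambda))^-1 < M ->
    asymptotic_on (fun t y => M <= t / enorm y)
      (fun t y => fine (resetting_density lambda t x y))
      (fun _ y =>
        lambda `^ ((d%:R + 1) / 4)
          / (2 `^ ((d%:R + 1) / 4) * pi `^ ((d%:R - 1) / 2))
        * (expR (- (Num.sqrt (2 * lambda) * enorm y))
          / enorm y `^ ((d%:R - 1) / 2))))
  /\
  (forall M : R, 0 < M -> M < (Num.sqrt (2 * lambda))^-1 ->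
    asymptotic_on (fun t y => 0 < t / enorm y <= M)
      (fun t y => fine (resetting_density lambda t x y))
      (fun t y =>
        expR (- (lambda * t)) * gauss_density t y
        * (2 * lambda / ((enorm y / t) ^+ 2 - 2 * lambda)
          + expR ((- enorm x ^+ 2 + 2 * dotp x y) / (2 * t)))))
  /\
  asymptotic_on (fun t y => t / enorm y = (Num.sqrt (2 * lambda))^-1)
    (fun t y => fine (resetting_density lambda t x y))
    (fun _ y =>
      lambda `^ ((d%:R + 1) / 4)
        / (2 * 2 `^ ((d%:R + 1) / 4) * pi `^ ((d%:R - 1) / 2))
      * (expR (- (Num.sqrt (2 * lambda) * enorm y))
        / enorm y `^ ((d%:R - 1) / 2))).
Proof.
split; [|split; [|split]].
- move=> dO Omega P Y N X HY HN HI HX t t0.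
  exact: (resetting_has_density hlambda t0 HY HN HI HX).
- move=> M aM.
  by apply: (resetting_density_beyond_critical x hlambda (M := M)
    (D := [set ty | M <= ty.1 / enorm ty.2])).
- move=> M M0 Ma.
  apply: (resetting_density_below_critical x hlambda (M := M)
    (D := [set ty | 0 < ty.1 / enorm ty.2 <= M])) => //.
  by move=> t y /andP[].
- have := @resetting_density_at_critical R d lambda x hlambda
    [set ty | ty.1 / enorm ty.2 = (Num.sqrt (2 * lambda))^-1] (fun _ _ => id).
  (* The two forms of the critical constant differ only in where the factor 2 stands. *)
  apply: cvg_trans; apply: near_eq_cvg; apply: nearW => ty /=; congr (_ / _).
  by rewrite !invfM; ring.
Qed.
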